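(* Let $n,m,p\ge 1$ be integers. Let the orthogonal group $O(n)$ act on $N$ by $U\circ(A,B,C)=(U^{\top}AU,\,U^{\top}B,\,CU)$, where $N$ is the set of triples $(A,B,C)$ with $A$ symmetric positive definite, $B\in\mathbf{R}^{n\times m}$, $C\in\mathbf{R}^{p\times n}$, that are both controllable and observable. Then the quotient set $N/O(n)$ is a manifold: it carries a smooth manifold structure for which the canonical projection $\pi:N\to N/O(n)$, $\pi(\Theta)=[\Theta]$, is a smooth submersion.
   Context: $\mathrm{Sym}_+(n)$ is the manifold of symmetric positive-definite real $n\times n$ matrices, an open subset of the vector space $\mathrm{Sym}(n)$ of symmetric real matrices. Put $M=\mathrm{Sym}_+(n)\times\mathbf{R}^{n\times m}\times\mathbf{R}^{p\times n}$. A triple $(A,B,C)$ is controllable (resp. observable) if the discrete-time system $\hat x_{k+1}=A\hat x_k+B\hat u_k$, $\hat y_k=C\hat x_k$ is controllable (resp. observable), i.e. $\mathrm{rank}\,(\lambda I_n-A\;\;B)=n$ for all $\lambda\in\mathbf{C}$ (resp. $\mathrm{rank}\begin{pmatrix}\lambda I_n-A\\ C\end{pmatrix}=n$ for all $\lambda\in\mathbf{C}$). $N$ is the set of $\Theta=(A,B,C)\in M$ that are controllable and observable; it is an open subset of $M$ and is given the corresponding smooth structure. $O(n)$ is the group of orthogonal $n\times n$ real matrices. The equivalence relation on $N$ is $\Theta_1\sim\Theta_2$ iff $\Theta_2=U\circ\Theta_1$ for some $U\in O(n)$; $[\Theta]$ is the class of $\Theta$ and $N/O(n)=\{[\Theta]\mid\Theta\in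 N\}$. *)

(* Defs.v *)
From HB Require Import structures.
From mathcomp Require Import all_boot all_order all_algebra.
From mathcomp Require Import all_classical all_reals all_analysis.
From mathcomp Require Import complex.

Set Implicit Arguments.
Unset Strict Implicit.
Unset Printing Implicit Defensive.

Import Order.TTheory GRing.Theory Num.Theory.
Import numFieldNormedType.Exports.

Local Open Scope classical_set_scope.
Local Open Scope ring_scope.
Local Open Scope quotient_scope.

Section Smooth.
Context {R : realType} {V W : normedModType R}.

(* In finite dimension, asking that f be differentiable on U and that
   x |-> 'd f x v be C^k for every v is the usual definition of C^(k+1). *)
Fixpoint Ck (k : nat) (U : set V) (f : V -> W) : Prop :=
  match k with
  | 0 => forall x, U x -> {for x, continuous f}
  | k'.+1 => (forall x, U x -> differentiable f x) /\
             (forall v : V, Ck k' U (fun x => 'd f x v))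
  end.

Definition smooth_on (U : set V) (f : V -> W) : Prop :=
  open U /\ forall k, Ck k U f.

End Smooth.

(* A chart on X with values in E; chart_fun is only meaningful on chart_dom. *)
Record chart (R : realType) (X : topologicalType) (E : normedModType R) :=
  Chart { chart_dom : set X ; chart_fun :> X -> E }.

Section Charts.
Context {R : realType}.

(* chart_fun is a homeomorphism from the open set chart_dom onto an open set *)
Definition is_chart (X : topologicalType) (E : normedModType R)
    (phi : chart X E) : Prop :=
  [/\ open (chart_dom phi),
      {in chart_dom phi &, injective phi},
      (forall x, chart_dom phi x -> {for x, continuous phi}) &
      (forall O : set X, open O -> O `<=` chart_dom phi -> open (phi @` O))].

(* psi o f o phi^-1; the point x0 is the junk value of phi^-1 outside
   phi (chart_dom phi). *)
Definition coord_map (X Y : topologicalType) (E F : normedModType R)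
    (x0 : X) (phi : chart X E) (psi : chart Y F) (f : X -> Y) : E -> F :=
  psi \o f \o 'pinv_(fun=> x0) (chart_dom phi) phi.

Definition smooth_coord (X Y : topologicalType) (E F : normedModType R)
    (phi : chart X E) (psi : chart Y F) (f : X -> Y) : Prop :=
  let D := chart_dom phi `&` f @^-1` chart_dom psi in
  forall x, D x -> smooth_on (phi @` D) (coord_map x phi psi f).

(* The smooth structure is the maximal atlas generated by A. *)
Definition smooth_manifold (X : topologicalType) (E : normedModType R)
    (A : set (chart X E)) : Prop :=
  [/\ hausdorff_space X, @second_countable X,
      (forall phi, A phi -> is_chart phi),
      (forall x, exists2 phi, A phi & chart_dom phi x) &
      (forall phi psi, A phi -> A psi -> smooth_coord phi psi id)].

Definition smooth_map (X Y : topologicalType) (E F : normedModType R)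
    (A : set (chart X E)) (B : set (chart Y F)) (f : X -> Y) : Prop :=
  continuous f /\
  forall phi psi, A phi -> B psi -> smooth_coord phi psi f.

Definition smooth_submersion (X Y : topologicalType) (E F : normedModType R)
    (A : set (chart X E)) (B : set (chart Y F)) (f : X -> Y) : Prop :=
  smooth_map A B f /\
  forall phi psi x, A phi -> B psi -> chart_dom phi x ->
    chart_dom psi (f x) ->
    forall w : F, exists v : E, 'd (coord_map x phi psi f) (phi x) v = w.

End Charts.

Section Sym.
Context {R : realType} {n : nat}.

Definition symmx_pred : {pred 'M[R]_n} := fun A => A^T == A.
Definition symmx := [qualify a A : 'M[R]_n | symmx_pred A].

Lemma symmx_submod : submod_closed symmx_pred.
Proof.
split=> [|a A B]; rewrite ?unfold_in /symmx_pred; first by rewrite trmx0.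
by move=> /eqP sA /eqP sB; rewrite linearP /= sA sB.
Qed.

HB.instance Definition _ :=
  GRing.isSubmodClosed.Build R 'M[R]_n symmx_pred symmx_submod.

End Sym.

Record sym (R : realType) (n : nat) :=
  Sym { sym_mx :> 'M[R]_n ; sym_mxP : sym_mx \is a symmx }.

Section SymNorm.
Context {R : realType} {n : nat}.

HB.instance Definition _ := [isSub for @sym_mx R n].
HB.instance Definition _ := [Choice of sym R n by <:].
HB.instance Definition _ := [SubChoice_isSubLmodule of sym R n by <:].

Definition sym_norm (A : sym R n) : R := `|sym_mx A|.

Lemma sym_normD A B : sym_norm (A + B) <= sym_norm A + sym_norm B.
Proof. exact: ler_normD. Qed.

Lemma sym_normZ (l : R) A : sym_norm (l *: A) = `|l| * sym_norm A.
Proof. exact: normrZ. Qed.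

Lemma sym_norm_eq0 A : sym_norm A = 0 -> A = 0.
Proof. by move=> /normr0_eq0 A0; apply: val_inj. Qed.

HB.instance Definition _ := Lmodule_isNormed.Build R (sym R n)
  sym_normD sym_normZ sym_norm_eq0.

End SymNorm.

Section Triples.
Context {R : realType} {n m p : nat}.

Definition posdef (A : 'M[R]_n) : Prop :=
  forall x : 'cV[R]_n, x != 0 -> 0 < (x^T *m A *m x) 0 0.

Definition controllable (A : 'M[R]_n) (B : 'M[R]_(n, m)) : Prop :=
  forall lambda : R[i],
    \rank (row_mx (lambda%:M - map_mx (real_complex R) A)
                  (map_mx (real_complex R) B)) = n.

Definition observable (A : 'M[R]_n) (C : 'M[R]_(p, n)) : Prop :=
  forall lambda : R[i],
    \rank (col_mx (lambda%:M - map_mx (real_complex R) A)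
                  (map_mx (real_complex R) C)) = n.

Definition orthogonal_mx (U : 'M[R]_n) : Prop := U^T *m U = 1%:M.

Lemma sym_conj_subproof (U : 'M[R]_n) (A : sym R n) :
  U^T *m A *m U \is a symmx.
Proof.
by rewrite qualifE /= /symmx_pred !trmx_mul trmxK (eqP (sym_mxP A)) mulmxA.
Qed.

Definition sym_conj (U : 'M[R]_n) (A : sym R n) : sym R n :=
  Sym (sym_conj_subproof U A).

End Triples.

(* the vector space Sym(n) x R^(n x m) x R^(p x n), in which N is open *)
Notation triple R n m p := (sym R n * 'M[R]_(n, m) * 'M[R]_(p, n))%type.

Section Quotient.
Context (R : realType) (n m p : nat).

Definition N : set (triple R n m p) :=
  [set T : triple R n m p | [/\ posdef T.1.1, controllable T.1.1 T.1.2 &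
                               observable T.1.1 T.2]].

(* The smooth structure of N as an open subset of the ambient space: its only
   chart is the inclusion.  That N is open is implied by the smoothness of any
   map out of N, as smooth_on requires an open domain. *)
Definition N_atlas : set (chart N (triple R n m p)) :=
  [set Chart setT (set_val : N -> triple R n m p)].

Definition act (U : 'M[R]_n) (T : triple R n m p) : triple R n m p :=
  (sym_conj U T.1.1, U^T *m T.1.2, T.2 *m U).

Definition orbit_rel : rel N := fun T1 T2 =>
  `[< exists2 U : 'M[R]_n, orthogonal_mx U & set_val T2 = act U (set_val T1) >].

Lemma act1 T : act 1%:M T = T.
Proof.
case: T => [[A B] C]; rewrite /act /= trmx1 mul1mx mulmx1.
by congr (_, _, _); apply: val_inj; rewrite /= trmx1 mul1mx mulmx1.
Qed.

Lemma actM U V T : act V (act U T) = act (U *m V) T.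
Proof.
rewrite /act /= trmx_mul !mulmxA; congr (_, _, _).
by apply: val_inj; rewrite /= trmx_mul !mulmxA.
Qed.

Lemma orbit_rel_refl : reflexive orbit_rel.
Proof.
move=> T; apply/asboolP; exists 1%:M; last by rewrite act1.
by rewrite /orthogonal_mx trmx1 mulmx1.
Qed.

Lemma orbit_rel_sym : symmetric orbit_rel.
Proof.
suff H T1 T2 : orbit_rel T1 T2 -> orbit_rel T2 T1.
  by move=> T1 T2; apply/idP/idP; exact: H.
move=> /asboolP[U oU eT]; apply/asboolP; have oU' := mulmx1C oU; exists U^T.
  by rewrite /orthogonal_mx trmxK.
by rewrite eT actM oU' act1.
Qed.

Lemma orbit_rel_trans : transitive orbit_rel.
Proof.
move=> T2 T1 T3 /asboolP[U oU e2] /asboolP[V oV e3].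
apply/asboolP; exists (U *m V); last by rewrite e3 e2 actM.
by rewrite /orthogonal_mx trmx_mul mulmxA -(mulmxA V^T) oU mulmx1.
Qed.

Canonical orbit_equiv :=
  EquivRel orbit_rel orbit_rel_refl orbit_rel_sym orbit_rel_trans.

(* N/O(n), with the quotient topology: the only topology for which the
   projection can be a submersion, a surjective submersion being open and
   continuous. *)
Definition N_mod_O : Type := quotient_topology {eq_quot orbit_equiv}.

HB.instance Definition _ := Topological.on N_mod_O.

Definition N_proj (T : N) : N_mod_O := \pi_({eq_quot orbit_equiv}) T.

End Quotient.

Arguments N : clear implicits.
Arguments N_atlas : clear implicits.
Arguments N_proj : clear implicits.

(* Main.v *)
Require Import Defs.
From HB Require Import structures.
From mathcomp Require Import all_boot all_order all_algebra.
From mathcomp Require Import all_classical all_reals all_analysis.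
From mathcomp Require Import complex ring lra.

Set Implicit Arguments.
Unset Strict Implicit.
Unset Printing Implicit Defensive.

Import Order.TTheory GRing.Theory Num.Theory.
Import numFieldNormedType.Exports.

Local Open Scope classical_set_scope.
Local Open Scope ring_scope.

(** The action of O(n) on N admits slices that are open pieces of linear coordinate
subspaces, and the rotation that brings a triple into a slice is given by an
explicit smooth formula, namely Gram-Schmidt.

Let [s] be a list of instructions, each one designating either a column of B or
an index i.  Gram-Schmidt along [s] builds q_0, q_1, ... by orthonormalizing, at
step k, either the designated column of B or the vector A q_i with i < k.  On the
set [gs_domain s] where no residual vanishes the q_k form an orthogonal matrix
Q that depends smoothly on the triple ([gram_schmidt_smooth]) and satisfies
Q(U o T) = U^T Q(T) ([gram_schmidt_equivariant]).  So the triple Q(T) o T depends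
only on the class of T; such normal forms are exactly the triples with Q = 1.
If q_0, ..., q_(k-1) are the first basis vectors, step k looks at a column of B
or at a column of A of index less than k, and producing the next basis vector
means that this column vanishes below row k and is positive in row k
([gram_schmidt_in_slice], [slice_gram_schmidt]).  The vanishing conditions
concern distinct entries of (A, B), one for each pair k < l; the remaining entries
are free, their number does not depend on [s] ([card_free_entries]), and reading
them off the normal form is the chart.  A change of charts is the inclusion of
one slice followed by the normal form map of another, hence smooth.  Undoing the
rotation Q on the slice gives a linear section of the projection through any
given triple, which yields the submersion property ([proj_diff_surjective]).

The sets [gs_domain s] cover N: if before step n every instruction has residual 0,
the span of the q_k is A-invariant and contains the image of B, so that a left
eigenvector of A orthogonal to this span contradicts the Hautus test
([controllable_nondegenerate]).
Conversely Gram-Schmidt can only succeed on controllable pairs, so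
controllability, and by transposition observability, is an open condition
([N_open]).  The quotient is Hausdorff because the entries of B^T A^c B and
C A^c B are continuous invariants that separate the orbits
([markov_separates]), and second countable because the projection is open. *)

(** * Smoothness calculus *)

Section Calculus.
Context {R : realType}.

(** The differential is a chosen linear map, so its dependence on the germ alone
has to be derived from uniqueness of the first-order expansion. *)
Lemma near_eq_diff (V W : normedModType R) (f g : V -> W) (x : V) :
  (\forall y \near x, f y = g y) -> differentiable f x ->
  differentiable g x /\ forall v, 'd g x v = 'd f x v.
Proof.
move=> fg df.
have fgx : f x = g x by exact: nbhs_singleton fg.
have [dfc dfx] := (diff_locallyP x f).1 df.
have key : g \o shift x = cst (g x) + 'd f x +o_ (0 : V) id.
  apply/eqaddoP => e e0.
  move/eqaddoP: dfx => /(_ e e0).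
  have : \forall y \near (0 : V), f (y + x) = g (y + x).
    by move: fg; rewrite (near_shift (0 : V)) subr0.
  apply: filterS2 => y E1; suff -> : (f \o shift x - (cst (f x) + 'd f x)) y =
    (g \o shift x - (cst (g x) + 'd f x)) y by [].
  by rewrite -fgx !fctE /= E1.
have E : 'd g x = 'd f x :> (V -> W) by exact: diff_unique.
split; last by move=> v; rewrite E.
by apply/diff_locallyP; rewrite E.
Qed.

Section Ck.
Context {V : normedModType R} (U : set V) (oU : open U).

(** Maps between charts agree with explicit formulas only on open sets; this is
what transfers smoothness from the formula to the map. *)
Lemma Ck_ext (W : normedModType R) k (f g : V -> W) :
  (forall x, U x -> f x = g x) -> Ck k U f -> Ck k U g.
Proof.
move=> fg.
have nfg x : U x -> \forall y \near x, f y = g y.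
  by move=> Ux; move: (open_nbhs_nbhs (conj oU Ux)); apply: filterS.
elim: k f g fg nfg => [|k IH] f g fg nfg /=.
  move=> cf x Ux; have := cf _ Ux; rewrite /prop_for /continuous_at (fg _ Ux).
  by apply: cvg_trans; apply: near_eq_cvg; exact: nfg.
move=> [df ddf]; have dg x Ux := near_eq_diff (nfg x Ux) (df x Ux).
split=> [x /dg[]//|v].
have E x : U x -> 'd f x v = 'd g x v by move=> /dg[_ ->].
apply: IH (ddf v) => // x Ux.
by move: (open_nbhs_nbhs (conj oU Ux)); apply: filterS.
Qed.

(** The inductive step of every closure property below: on U the differential may
be replaced by a formula. *)
Lemma Ck_step (W : normedModType R) k (f : V -> W) (g : V -> V -> W) :
  (forall x, U x -> differentiable f x) ->
  (forall v x, U x -> 'd f x v = g v x) -> (forall v, Ck k U (g v)) ->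
  Ck k.+1 U f.
Proof.
move=> df dfE Cg; split=> // v; apply: Ck_ext (Cg v) => x Ux.
by rewrite dfE.
Qed.

Lemma Ck_pred (W : normedModType R) k (f : V -> W) : Ck k.+1 U f -> Ck k U f.
Proof.
elim: k f => [|k IH] f [df ddf].
  by move=> x /df; exact: differentiable_continuous.
by split=> // v; exact: IH.
Qed.

Lemma Ck_cst (W : normedModType R) k (w : W) : Ck k U (fun=> w).
Proof.
elim: k w => [|k IH] w; first by move=> x _; exact: cst_continuous.
apply: (Ck_step (g := fun _ _ => 0)) => [x _|v x _|//]; first exact: differentiable_cst.
by have /(congr1 (fun h => h v)) := diff_cst w x.
Qed.

Lemma CkD (W : normedModType R) k (f g : V -> W) :
  Ck k U f -> Ck k U g -> Ck k U (fun x => f x + g x).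
Proof.
elim: k f g => [|k IH] f g.
  by move=> cf cg x Ux; apply: cvgD; [exact: cf|exact: cg].
move=> [df ddf] [dg ddg].
apply: (Ck_step (g := fun v x => 'd f x v + 'd g x v)) => [x Ux|v x Ux|v].
- by apply: differentiableD; [exact: df|exact: dg].
- by have /(congr1 (fun h => h v)) := diffD (df x Ux) (dg x Ux).
- by apply: IH; [exact: ddf|exact: ddg].
Qed.

Lemma Ck_sum (W : normedModType R) (I : Type) (r : seq I) (P : pred I) k
    (f : I -> V -> W) :
  (forall i, Ck k U (f i)) -> Ck k U (fun x => \sum_(i <- r | P i) f i x).
Proof.
move=> Cf; elim: r => [|i r IH].
  by apply: Ck_ext (Ck_cst k 0) => x _; rewrite big_nil.
have E : (if P i then fun x => f i x + \sum_(j <- r | P j) f j x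
   else fun x => \sum_(j <- r | P j) f j x) =
   (fun x => \sum_(j <- i :: r | P j) f j x).
  by apply/funext => x; rewrite big_cons; case: ifP.
by rewrite -E; case: ifP => // _; apply: CkD.
Qed.

Lemma CkM k (f g : V -> R) :
  Ck k U f -> Ck k U g -> Ck k U (fun x => f x * g x).
Proof.
elim: k f g => [|k IH] f g.
  by move=> cf cg x Ux; apply: cvgM; [exact: cf|exact: cg].
move=> Cf Cg; have [df ddf] := Cf; have [dg ddg] := Cg.
apply: (Ck_step (g := fun v x => f x * 'd g x v + g x * 'd f x v)) => [x Ux|v x Ux|v].
- by apply: differentiableM; [exact: df|exact: dg].
- by have /(congr1 (fun h => h v)) := diffM (df x Ux) (dg x Ux).
- by apply: CkD; apply: IH; [exact: Ck_pred|exact: ddg|exact: Ck_pred|exact: ddf].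
Qed.

Lemma CkZl (W : normedModType R) k (f : V -> R) (w : W) :
  Ck k U f -> Ck k U (fun x => f x *: w).
Proof.
elim: k f => [|k IH] f.
  by move=> cf x Ux; apply: cvgZ; [exact: cf|exact: cvg_cst].
move=> [df ddf].
apply: (Ck_step (g := fun v x => 'd f x v *: w)) => [x Ux|v x Ux|v].
- by apply: differentiableZl; exact: df.
- by have /(congr1 (fun h => h v)) := diffZl w (df x Ux).
- exact: IH (ddf v).
Qed.

End Ck.

Definition rsqrt (x : R) : R := (Num.sqrt x)^-1.

Lemma rsqrt_sqr (c : R) : 0 < c -> rsqrt (c ^+ 2) = c^-1.
Proof. by move=> c0; rewrite /rsqrt sqrtr_sqr gtr0_norm. Qed.

Lemma rsqrt_normalize (x : R) : 0 < x -> rsqrt x * rsqrt x * x = 1.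
Proof.
move=> x0; rewrite -[in X in _ * X](sqr_sqrtr (ltW x0)) /rsqrt -invfM -expr2.
by rewrite mulVf // expf_neq0 // gt_eqF // sqrtr_gt0.
Qed.

Lemma differentiable_rsqrt (x : R) : 0 < x ->
  differentiable rsqrt x /\ forall h, 'd rsqrt x h = h * (- 2^-1 * rsqrt x ^+ 3).
Proof.
move=> x0.
have s0 : Num.sqrt x != 0 by rewrite gt_eqF// sqrtr_gt0.
have ds : is_derive x 1 (Num.sqrt : R -> R) (2 * Num.sqrt x)^-1 by exact: is_derive1_sqrt.
have dd : derivable rsqrt x 1 by apply: (derivableV s0); exact: ex_derive.
split; first exact/derivable1_diffP.
move=> h; have /(congr1 (fun u => u h)) -> := diff1E ((derivable1_diffP rsqrt x).1 dd).
rewrite derive1E (deriveV s0) ?derive_val; last by apply: ex_derive.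
have ringE (a b c : R) : c * (- a ^+ 2 * (b * a)) = c * (- b * a ^+ 3) by ring.
by rewrite /rsqrt -exprVn invfM; exact: ringE.
Qed.

(** The derivative of x^(-1/2) is -1/2 times its cube, so smoothness propagates by
induction using products only.  Together with sums and products this is the only
function that normalizing a vector requires. *)
Lemma Ck_rsqrt (V : normedModType R) (U : set V) (oU : open U) k (f : V -> R) :
  (forall x, U x -> 0 < f x) -> Ck k U f -> Ck k U (fun x => rsqrt (f x)).
Proof.
move=> f0; elim: k f f0 => [|k IH] f f0.
  move=> cf x Ux; apply: continuous_comp; first exact: cf.
  by apply: differentiable_continuous; have [] := differentiable_rsqrt (f0 _ Ux).
move=> Cf; have [df ddf] := Cf.
have Ck' : Ck k U (fun x => rsqrt (f x)) by apply: IH => //; exact: Ck_pred.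
apply: (Ck_step oU (g := fun v x => 'd f x v *
   (- 2^-1 * (rsqrt (f x) * (rsqrt (f x) * rsqrt (f x)))))) => [x Ux|v x Ux|v].
- apply: (differentiable_comp (g := rsqrt)); first exact: df.
  by have [] := differentiable_rsqrt (f0 _ Ux).
- have [dr drE] := differentiable_rsqrt (f0 _ Ux).
  by have /(congr1 (fun h => h v)) -> := diff_comp (df x Ux) dr; rewrite /= drE.
- apply: (CkM oU (f := fun x => 'd f x v)); first exact: ddf.
  apply: (CkM oU (f := fun=> - 2^-1)); first exact: (Ck_cst oU).
  by apply: (CkM oU) => //; apply: (CkM oU).
Qed.

(** The differential of [f \o L] in the direction [v] is that of [f] in the direction
[L v], again precomposed with [L], so the induction closes. *)
Lemma Ck_comp_linear (V V' W : normedModType R) (L : {linear V' -> V})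
    (U : set V) k (f : V -> W) :
  continuous L -> open U -> Ck k U f -> Ck k (L @^-1` U) (f \o L).
Proof.
move=> cL oU; have oU' : open (L @^-1` U) by exact: open_comp.
elim: k f => [|k IH] f.
  by move=> cf x Ux; apply: continuous_comp; [exact: cL|exact: cf].
move=> [df ddf].
have dL x : differentiable L x by exact: linear_differentiable.
apply: (Ck_step oU' (g := fun v => (fun x => 'd f x (L v)) \o L)) => [x Ux|v x Ux|v].
- by apply: differentiable_comp => //; exact: df.
- have /(congr1 (fun h => h v)) -> := diff_comp (dL x) (df _ Ux).
  by rewrite /=; congr ('d f (L x) _); have /(congr1 (fun h => h v)) := diff_lin x cL.
- exact: IH (ddf (L v)).
Qed.

Lemma Ck_subset (V W : normedModType R) (U U' : set V) k (f : V -> W) :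
  U' `<=` U -> Ck k U f -> Ck k U' f.
Proof.
move=> UU; elim: k f => [|k IH] f; first by move=> cf x /UU; exact: cf.
by move=> [df ddf]; split=> [x /UU|v]; [exact: df|exact: IH (ddf v)].
Qed.

Lemma Ck_linear (V W : normedModType R) (U : set V) k (L : {linear V -> W}) :
  open U -> continuous L -> Ck k U L.
Proof.
move=> oU cL; case: k => [|k]; first by move=> x _; exact: cL.
apply: (Ck_step oU (g := fun v _ => L v)) => [x _|v x _|v].
- exact: linear_differentiable.
- by have /(congr1 (fun h => h v)) := diff_lin x cL.
- exact: (Ck_cst oU).
Qed.

End Calculus.

(** * Gram-Schmidt on Krylov vectors *)

Section GramSchmidt.
Context {R : realType}.

Definition sqnorm n (r : 'cV[R]_n) : R := (r^T *m r) 0 0.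

Lemma sqnormE n (r : 'cV[R]_n) : sqnorm r = \sum_i r i 0 ^+ 2.
Proof. by rewrite /sqnorm mxE; apply: eq_bigr => i _; rewrite mxE. Qed.

Lemma sqnorm_gt0 n (r : 'cV[R]_n) : r != 0 -> 0 < sqnorm r.
Proof.
move=> r0; rewrite lt_def sqnormE sumr_ge0 ?andbT => [|i _]; last exact: sqr_ge0.
apply: contra_neq r0 => /eqP; rewrite psumr_eq0 => [/allP z|i _]; last exact: sqr_ge0.
apply/colP => i; rewrite mxE; apply/eqP.
by have := z i (mem_index_enum _); rewrite /= sqrf_eq0.
Qed.

Context {n m : nat}.
Implicit Types (A : 'M[R]_n) (B : 'M[R]_(n, m)) (s : nat -> 'I_m + 'I_n).

(** A basis row vector indexed by a natural number; it is zero when [k] is out of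
range. *)
Definition unit_row k : 'rV[R]_n := \row_j (j == k :> nat)%:R.

(** The orthogonal projection onto the span of the first [k] basis vectors. *)
Definition trunc_mx k : 'M[R]_n := \matrix_(i, j) ((i == j) && (i < k)%N)%:R.

(** The vector to which one step is applied, when the columns of [P] are the
orthonormal vectors found so far, padded with zero columns. *)
Definition krylov_src A B (x : 'I_m + 'I_n) (P : 'M[R]_n) : 'cV[R]_n :=
  match x with inl j => col j B | inr i => A *m col i P end.

Definition residual A B x (P : 'M[R]_n) : 'cV[R]_n :=
  krylov_src A B x P - P *m (P^T *m krylov_src A B x P).

(** Carrying the whole n x n matrix, with zeros in the columns not yet built, makes
every step a matrix identity: [P *m P^T] is the projection onto the span of the
vectors already found.  An instruction that refers to a column not yet built
produces the residual 0. *)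
Fixpoint gram_schmidt s A B k : 'M[R]_n :=
  if k is k'.+1 then
    let P := gram_schmidt s A B k' in
    let r := residual A B (s k') P in
    P + rsqrt (sqnorm r) *: (r *m unit_row k')
  else 0.

Definition pivot s A B k : R :=
  sqnorm (residual A B (s k) (gram_schmidt s A B k)).

Definition nondegenerate s A B k := forall j, (j < k)%N -> 0 < pivot s A B j.

Lemma trunc_mx0 : trunc_mx 0 = 0.
Proof. by apply/matrixP => i j; rewrite !mxE ltn0 andbF. Qed.

Lemma trunc_mxn : trunc_mx n = 1%:M.
Proof. by apply/matrixP => i j; rewrite !mxE ltn_ord andbT. Qed.

Lemma trunc_mxS k : trunc_mx k.+1 = trunc_mx k + (unit_row k)^T *m unit_row k.
Proof.
apply/matrixP => i j; rewrite !mxE big_ord1 !mxE -natrM -natrD; congr (_%:R).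
have [->|nij] := eqVneq i j; first by rewrite /= ltnS; case: ltngtP.
by case: eqP => //= ik; case: eqP => //= jk; case/eqP: nij; apply: val_inj; rewrite /= ik jk.
Qed.

Lemma trunc_mxT k : (trunc_mx k)^T = trunc_mx k.
Proof.
apply/matrixP => i j; rewrite !mxE eq_sym.
by have [->|] := eqVneq i j.
Qed.

Lemma gram_schmidt_trunc s A B k :
  gram_schmidt s A B k *m trunc_mx k = gram_schmidt s A B k.
Proof.
have trS j : trunc_mx j *m trunc_mx j.+1 = trunc_mx j.
  apply/matrixP => a b; rewrite mxE (bigD1 a) //= big1 => [|c ca].
    rewrite !mxE eqxx addr0 -natrM mulnb /= ltnS andbCA; congr (nat_of_bool (_ && _))%:R.
    by case: ltngtP.
  by rewrite !mxE eq_sym (negPf ca) mul0r.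
have uS j : unit_row j *m trunc_mx j.+1 = unit_row j.
  apply/rowP => a; rewrite mxE (bigD1 a) //= big1 => [|c ca].
    rewrite !mxE eqxx addr0 -natrM mulnb /= ltnS; congr (nat_of_bool _)%:R.
    by case: ltngtP.
  by rewrite !mxE (negPf ca) mulr0.
elim: k => [|k IH] /=; first by rewrite mul0mx.
by rewrite mulmxDl -scalemxAl -(mulmxA _ _ (trunc_mx _)) uS -[in LHS]IH -mulmxA trS IH.
Qed.

Lemma gram_schmidt_ext s s' A B k : (forall j, (j < k)%N -> s j = s' j) ->
  gram_schmidt s A B k = gram_schmidt s' A B k.
Proof.
elim: k => //= k IH ss; rewrite IH ?ss // => j jk; exact/ss/ltnW.
Qed.

(** The new column is orthogonal to the previous ones because the residual is
annihilated by [P^T], and it is a unit vector by the choice of the scalar. *)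
Lemma gram_schmidt_orth s A B k : nondegenerate s A B k ->
  (gram_schmidt s A B k)^T *m gram_schmidt s A B k = trunc_mx k.
Proof.
elim: k => [|k IH] nd /=; first by rewrite mulmx0 trunc_mx0.
have {}IH := IH (fun j jk => nd j (ltnW jk)).
have := gram_schmidt_trunc s A B k; have := nd _ (ltnSn k); rewrite /pivot.
move: IH; set P := gram_schmidt s A B k; set r := residual _ _ _ _ => PP rho PD.
have Pr : P^T *m r = 0.
  by rewrite /r /residual mulmxBr !mulmxA PP -[in trunc_mx k *m _]trunc_mxT -trmx_mul PD subrr.
have rP : r^T *m P = 0 by rewrite -[P]trmxK -trmx_mul Pr trmx0.
have rr : r^T *m r = (sqnorm r)%:M by rewrite /sqnorm -mx11_scalar.
rewrite trunc_mxS [X in X *m _]linearD /= [X in (_ + X) *m _]linearZ /= trmx_mul mulmxDl.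
rewrite !mulmxDr PP -addrA; congr (_ + _).
rewrite -[X in X + _]scalemxAr mulmxA Pr mul0mx scaler0 add0r.
rewrite -[X in X + _]scalemxAl -(mulmxA _ _ P) rP mulmx0 scaler0 add0r.
rewrite -scalemxAr -scalemxAl -mulmxA (mulmxA r^T) rr mul_scalar_mx -scalemxAr.
by rewrite !scalerA rsqrt_normalize // scale1r.
Qed.

(** Only inner products enter, and these do not see the rotation [U]. *)
Lemma residual_equivariant A B x (U P : 'M[R]_n) : orthogonal_mx U ->
  residual (U^T *m A *m U) (U^T *m B) x (U^T *m P) = U^T *m residual A B x P.
Proof.
move=> oU; have oU' := mulmx1C oU.
have srcE : krylov_src (U^T *m A *m U) (U^T *m B) x (U^T *m P) =
    U^T *m krylov_src A B x P.
  case: x => [j|i] /=; rewrite !colE -!mulmxA //.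
  by rewrite (mulmxA U) oU' mul1mx.
rewrite /residual srcE mulmxBr trmx_mul trmxK -!mulmxA (mulmxA U) oU' mul1mx.
by rewrite !mulmxA.
Qed.

Lemma sqnorm_orthogonal (U : 'M[R]_n) (r : 'cV[R]_n) : orthogonal_mx U ->
  sqnorm (U^T *m r) = sqnorm r.
Proof.
move=> /mulmx1C oU'.
by rewrite /sqnorm trmx_mul trmxK -!mulmxA (mulmxA U) oU' mul1mx.
Qed.

Lemma gram_schmidt_equivariant s A B (U : 'M[R]_n) k : orthogonal_mx U ->
  gram_schmidt s (U^T *m A *m U) (U^T *m B) k = U^T *m gram_schmidt s A B k.
Proof.
move=> oU; elim: k => [|k IH] /=; first by rewrite mulmx0.
rewrite IH residual_equivariant // sqnorm_orthogonal //.
by rewrite [RHS]mulmxDr -[in RHS]scalemxAr mulmxA.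
Qed.

Lemma pivot_invariant s A B (U : 'M[R]_n) k : orthogonal_mx U ->
  pivot s (U^T *m A *m U) (U^T *m B) k = pivot s A B k.
Proof.
move=> oU; rewrite /pivot gram_schmidt_equivariant // residual_equivariant //.
exact: sqnorm_orthogonal.
Qed.

Definition slice_col A B (x : 'I_m + 'I_n) : 'cV[R]_n :=
  match x with inl j => col j B | inr i => col i A end.

(** The conditions that characterize the triples whose Gram-Schmidt matrix is the
identity: linear equations and strict inequalities on entries of A and B. *)
Definition in_slice s A B := forall k : 'I_n,
  0 < slice_col A B (s k) k 0 /\
  forall l : 'I_n, (k < l)%N -> slice_col A B (s k) l 0 = 0.

(** The instruction sequences that can be carried out: no instruction is repeated,
and an index refers to a vector built before. *)
Definition admissible s :=
  (forall k k' : 'I_n, s k = s k' -> k = k') /\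
  (forall (k i : 'I_n), s k = inr i -> (i < k)%N).

Lemma col_trunc k (i : 'I_n) :
  col i (trunc_mx k) = if (i < k)%N then delta_mx i 0 else 0.
Proof.
apply/colP => j; case: ifPn => ik; rewrite !mxE ?eqxx ?andbT.
  by case: eqP => [->|//]; rewrite ik.
by case: eqP => [->|//]; rewrite (negPf ik).
Qed.

Lemma krylov_src_trunc A B k x : (forall i : 'I_n, x = inr i -> (i < k)%N) ->
  krylov_src A B x (trunc_mx k) = slice_col A B x.
Proof. by case: x => //= i /(_ i erefl) ik; rewrite col_trunc ik -colE. Qed.

Lemma truncM k (w : 'cV[R]_n) (l : 'I_n) :
  (trunc_mx k *m w) l 0 = if (l < k)%N then w l 0 else 0.
Proof.
rewrite mxE (bigD1 l) //= big1 => [|c ca].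
  by rewrite !mxE eqxx addr0 /=; case: ifP; rewrite ?mul1r ?mul0r.
by rewrite !mxE eq_sym (negPf ca) mul0r.
Qed.

Lemma trunc_mx_idem k : trunc_mx k *m trunc_mx k = trunc_mx k.
Proof.
apply/matrixP => i j.
rewrite mxE (bigD1 i) //= big1 => [|c ci]; last by rewrite !mxE eq_sym (negPf ci) mul0r.
by rewrite !mxE eqxx addr0 /=; case: (_ < _)%N; rewrite ?mul1r ?mul0r ?andbT ?andbF.
Qed.

Lemma residual_trunc A B k x : (forall i : 'I_n, x = inr i -> (i < k)%N) ->
  residual A B x (trunc_mx k) =
  slice_col A B x - trunc_mx k *m slice_col A B x.
Proof.
by move=> xk; rewrite /residual krylov_src_trunc // trunc_mxT mulmxA trunc_mx_idem.
Qed.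

(** On the slice, the residual of step [k] is the positive entry in row [k] times
the basis vector e_k, because the entries above row [k] are removed by the
projection and those below vanish. *)
Lemma slice_gram_schmidt s A B k : admissible s -> in_slice s A B ->
  (k <= n)%N -> gram_schmidt s A B k = trunc_mx k /\ nondegenerate s A B k.
Proof.
move=> [_ sk] sl; elim: k => [|k IH] kn; first by rewrite trunc_mx0.
have [Pk nd] := IH (ltnW kn).
pose o : 'I_n := Ordinal kn; have [w0 wl] := sl o.
have resE : residual A B (s k) (trunc_mx k) = slice_col A B (s o) o 0 *: delta_mx o 0.
  rewrite residual_trunc => [|i /(sk o)//].
  apply/colP => l; rewrite mxE [X in _ + X]mxE truncM [RHS]mxE [delta_mx _ _ _ _]mxE eqxx andbT.
  have [lk|kl|lk] := ltngtP l k.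
  - by rewrite /= subrr -val_eqE /= (ltn_eqF lk) mulr0.
  - by rewrite /= wl // subr0 -val_eqE /= (gtn_eqF kl) mulr0.
  - by rewrite /= subr0 -val_eqE /= lk eqxx mulr1; congr (_ _ 0); apply: val_inj.
have sqE : sqnorm (slice_col A B (s o) o 0 *: delta_mx o 0 : 'cV_n) = slice_col A B (s o) o 0 ^+ 2.
  rewrite sqnormE (bigD1 o) //= big1 => [|i io]; rewrite !mxE ?eqxx ?addr0 ?mulr1 //.
  by rewrite (negPf io) mulr0 expr0n.
split.
  rewrite /= Pk resE sqE rsqrt_sqr // -scalemxAl scalerA mulVf ?gt_eqF // scale1r.
  rewrite trunc_mxS; congr (_ + _ *m _); apply/colP => l.
  by rewrite !mxE eqxx andbT -val_eqE.
move=> j; rewrite ltnS leq_eqVlt => /orP[/eqP ->|/nd//].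
by rewrite /pivot Pk resE sqE exprn_gt0.
Qed.

(** The first [k] columns of the final matrix are those built after [k] steps. *)
Lemma gram_schmidt_prefix s A B k : (k <= n)%N -> nondegenerate s A B n ->
  (gram_schmidt s A B n)^T *m gram_schmidt s A B k = trunc_mx k.
Proof.
move=> kn nd.
suff -> : gram_schmidt s A B k = gram_schmidt s A B n *m trunc_mx k.
  by rewrite mulmxA gram_schmidt_orth // trunc_mxn mul1mx.
have key d : (gram_schmidt s A B (d + k)) *m trunc_mx k = gram_schmidt s A B k.
  elim: d => [|d IH]; first by rewrite gram_schmidt_trunc.
  rewrite /= mulmxDl IH -scalemxAl -mulmxA.
  suff -> : unit_row (d + k) *m trunc_mx k = 0 by rewrite mulmx0 scaler0 addr0.
  apply/rowP => j; rewrite !mxE big1 // => i _; rewrite !mxE.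
  have [->|] := eqVneq (i : nat) (d + k)%N; last by rewrite mul0r.
  by rewrite ltnNge leq_addl andbF mulr0.
by rewrite -(key (n - k)%N) subnK.
Qed.

Lemma orthogonal_gram_schmidt s A B : nondegenerate s A B n ->
  orthogonal_mx (gram_schmidt s A B n).
Proof. by move=> nd; rewrite /orthogonal_mx gram_schmidt_orth // trunc_mxn. Qed.

(** If every step produces the next basis vector, then the residual of step [k] is a
positive multiple of e_k, which is the slice condition.  Admissibility follows: an
instruction pointing too far yields the residual 0, and a repeated instruction
would need an entry that is both zero and positive. *)
Lemma in_slice_of_trunc s A B :
  (forall k, (k <= n)%N -> gram_schmidt s A B k = trunc_mx k) ->
  nondegenerate s A B n -> admissible s /\ in_slice s A B.
Proof.
move=> Pk rho.
have Pord (k : 'I_n) : gram_schmidt s A B k = trunc_mx k.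
  by apply: Pk; exact/ltnW/ltn_ord.
have sk (k i : 'I_n) : s k = inr i -> (i < k)%N.
  move=> ski; rewrite ltnNge; apply/negP => ki.
  have := rho k (ltn_ord k); rewrite /pivot Pord ski /residual /=.
  rewrite col_trunc ltnNge ki /= !mulmx0 subr0 sqnormE big1 ?ltxx // => l _.
  by rewrite mxE expr0n.
have sl : in_slice s A B.
  move=> k; set w := slice_col A B (s k).
  have rE : residual A B (s k) (trunc_mx k) = w - trunc_mx k *m w.
    by rewrite residual_trunc // => i /sk.
  have := Pk _ (ltn_ord k); rewrite /= Pord trunc_mxS => /addrI.
  have := rho k (ltn_ord k); rewrite /pivot Pord rE; set q := sqnorm _ => q0 E.
  have c0 : 0 < rsqrt q by rewrite invr_gt0 sqrtr_gt0.
  have rE2 (l : 'I_n) : rsqrt q * (w - trunc_mx k *m w) l 0 = (l == k)%:R.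
    move: E; set r := w - _ => /matrixP/(_ l k).
    by rewrite !mxE !big_ord1 !mxE eqxx !mulr1.
  split.
    have := rE2 k; rewrite mxE [X in _ + X]mxE truncM ltnn subr0 eqxx => cw.
    by rewrite -(pmulr_rgt0 _ c0) cw.
  move=> l kl; have := rE2 l; rewrite mxE [X in _ + X]mxE truncM ltnNge ltnW //= subr0.
  rewrite -val_eqE /= gtn_eqF // => /eqP; rewrite mulf_eq0 gt_eqF //=.
  by move/eqP.
split=> //; split=> // k k' skk'; apply/eqP; rewrite -val_eqE /=.
have [kk|kk|//] := ltngtP k k'.
  have [_ /(_ _ kk) z] := sl k; have [p _] := sl k'.
  by move: p; rewrite -skk' z ltxx.
have [_ /(_ _ kk) z] := sl k'; have [p _] := sl k.
by move: p; rewrite skk' z ltxx.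
Qed.

(** By equivariance, Gram-Schmidt on the rotated triple yields [Q^T *m Q], that
is, the basis vectors. *)
Lemma gram_schmidt_in_slice s A B : nondegenerate s A B n ->
  let Q := gram_schmidt s A B n in
  admissible s /\ in_slice s (Q^T *m A *m Q) (Q^T *m B).
Proof.
move=> nd Q; have oQ : orthogonal_mx Q by exact: orthogonal_gram_schmidt.
apply: in_slice_of_trunc => k kn.
  by rewrite gram_schmidt_equivariant // gram_schmidt_prefix.
by rewrite pivot_invariant //; exact: nd.
Qed.

End GramSchmidt.

(** * The Hautus test *)

Section Hautus.
Context {R : realType} {n m : nat}.
Implicit Types (A : 'M[R]_n) (B : 'M[R]_(n, m)) (s : nat -> 'I_m + 'I_n).

Local Notation toC := (map_mx (real_complex R)).

(** The Popov-Belevitch-Hautus form: no left eigenvector of A annihilates B. *)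
Lemma controllableP A B : controllable A B <->
  forall (lambda : R[i]) (u : 'rV[R[i]]_n),
    u *m toC A = lambda *: u -> u *m toC B = 0 -> u = 0.
Proof.
split=> [cAB lambda u uA uB|uAB lambda].
  have /eqP free : row_free (row_mx (lambda%:M - toC A) (toC B)) by apply/eqP; exact: cAB.
  apply/eqP; rewrite -(mulmx_free_eq0 _ (introT eqP free)).
  by rewrite mul_mx_row mulmxBr mul_mx_scalar uA uB subrr row_mx0.
apply/eqP; rewrite -/(row_free _); apply: inj_row_free => u.
rewrite mul_mx_row mulmxBr mul_mx_scalar => /eqP; rewrite row_mx_eq0.
by move=> /andP[/eqP/subr0_eq/esym uA /eqP]; exact: uAB uA.
Qed.

Lemma observable_tr p A (C : 'M[R]_(p, n)) :
  observable A C <-> controllable A^T C^T.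
Proof.
suff E (lambda : R[i]) : \rank (col_mx (lambda%:M - toC A) (toC C)) =
    \rank (row_mx (lambda%:M - toC A^T) (toC C^T)).
  by split=> h lambda; [rewrite -E|rewrite E]; exact: h.
by rewrite -mxrank_tr tr_col_mx linearB /= tr_scalar_mx !map_trmx.
Qed.

(** A left eigenvector of A that annihilates B annihilates, by induction, every
vector built by Gram-Schmidt, hence a basis. *)
Lemma nondegenerate_controllable s A B : nondegenerate s A B n -> controllable A B.
Proof.
move=> nd; apply/controllableP => lambda u uA uB.
have uP k : u *m toC (gram_schmidt s A B k) = 0.
  elim: k => [|k IH] /=; first by rewrite map_mx0 mulmx0.
  rewrite map_mxD mulmxDr IH add0r map_mxZ -scalemxAr map_mxM mulmxA.
  suff -> : u *m toC (residual A B (s k) (gram_schmidt s A B k)) = 0.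
    by rewrite mul0mx scaler0.
  rewrite /residual map_mxB mulmxBr map_mxM mulmxA IH mul0mx subr0.
  case: (s k) => [j|i] /=; first by rewrite map_col colE mulmxA uB mul0mx.
  by rewrite map_mxM mulmxA uA map_col colE -scalemxAl mulmxA IH mul0mx scaler0.
have := mulmx1C (orthogonal_gram_schmidt nd) => PP.
by rewrite -[u]mulmx1 -(map_mx1 (real_complex R)) -PP map_mxM mulmxA uP mul0mx.
Qed.

(** The hypothesis says that the row space of [K] is stable under [M], so [M]
restricted to it has an eigenvalue. *)
Lemma stable_left_eigenvector (K M : 'M[R[i]]_n) : K != 0 -> K *m M = K *m M *m K ->
  exists (lambda : R[i]) (u : 'rV[R[i]]_n),
    [/\ u != 0, u *m M = lambda *: u & exists w, u = w *m K].
Proof.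
move=> K0 KM.
have stab : (row_base K *m M <= row_base K)%MS.
  rewrite eq_row_base; have /submxP[D ->] : (row_base K <= K)%MS by rewrite eq_row_base.
  by rewrite -mulmxA KM mulmxA submxMl.
have [D DE] := submxP stab.
have [|lambda /eigenvalueP[v vD v0]] := eigenvalue_closed D.
  by rewrite lt0n mxrank_eq0.
exists lambda, (v *m row_base K); split.
- by rewrite mulmx_free_eq0 ?row_base_free.
- by rewrite -mulmxA DE mulmxA vD scalemxAl.
- by apply/submxP; rewrite -(eq_row_base K) submxMl.
Qed.

(** If all residuals vanish then the span of the columns of [P] contains the image
of B and is stable under A, so its orthogonal complement, the row space of
[1 - P P^T], contains a left eigenvector that violates the Hautus test. *)
Lemma exists_residual_neq0 s A B k : controllable A B -> (k < n)%N ->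
  nondegenerate s A B k -> exists x, residual A B x (gram_schmidt s A B k) != 0.
Proof.
move=> /controllableP cAB kn nd; apply: contrapT => /forallNP res0.
set P := gram_schmidt s A B k in res0.
have PP : P^T *m P = trunc_mx k := gram_schmidt_orth nd.
have PD : P *m trunc_mx k = P := gram_schmidt_trunc s A B k.
pose K := 1%:M - P *m P^T.
have Ksrc x : K *m krylov_src A B x P = 0.
  have /negP/negPn/eqP := res0 x.
  by rewrite /residual /K mulmxBl mul1mx mulmxA.
have cols0 q (M : 'M[R]_(n, q)) : (forall j, col j M = 0) -> M = 0.
  by move=> M0; apply/matrixP => i j; have /colP/(_ i) := M0 j; rewrite !mxE.
have KB : K *m B = 0.
  by apply: cols0 => j; have := Ksrc (inl j); rewrite /= !colE mulmxA.
have KAP : K *m A *m P = 0.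
  by apply: cols0 => i; have := Ksrc (inr i); rewrite /= !colE !mulmxA.
have KA : K *m A = K *m A *m K.
  by rewrite {3}/K mulmxBr mulmx1 mulmxA KAP mul0mx subr0.
have K0 : K != 0.
  apply/eqP => /subr0_eq/esym/mulmx1C; rewrite PP.
  move=> /matrixP/(_ (Ordinal kn) (Ordinal kn)); rewrite !mxE eqxx /= ltnn.
  by move/eqP; rewrite eq_sym oner_eq0.
have Kc0 : toC K != 0 by rewrite map_mx_eq0.
have KAc : toC K *m toC A = toC K *m toC A *m toC K by rewrite -!map_mxM -KA.
have [lambda [u [u0 uA [w uw]]]] := stable_left_eigenvector Kc0 KAc.
move/eqP: u0; apply; apply: cAB uA _.
by rewrite uw -mulmxA -map_mxM KB map_mx0 mulmx0.
Qed.

Lemma controllable_nondegenerate A B : (0 < n)%N -> controllable A B ->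
  exists s, nondegenerate s A B n.
Proof.
move=> n0 cAB; suff: forall k, (k <= n)%N -> exists s, nondegenerate s A B k.
  exact.
elim=> [_|k IH kn]; first by exists (fun=> inr (Ordinal n0)).
have [s nd] := IH (ltnW kn).
have [x x0] := exists_residual_neq0 cAB kn nd.
pose s' j := if j == k then x else s j.
have gsE j : (j <= k)%N -> gram_schmidt s' A B j = gram_schmidt s A B j.
  move=> jk; apply: gram_schmidt_ext => i ij.
  by rewrite /s' ltn_eqF // (leq_trans ij).
exists s' => j; rewrite ltnS leq_eqVlt => /orP[/eqP ->|jk].
  by rewrite /pivot gsE // /s' eqxx sqnorm_gt0.
by rewrite /pivot gsE ?(ltnW jk) // /s' ltn_eqF //; exact: nd.
Qed.

End Hautus.

(** * Entries of a triple *)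

Section Entries.
Context {R : realType} {n m p : nat}.
Local Notation V := (triple R n m p).

(** All n x n positions are kept for the symmetric component, although they are
pairwise redundant; this makes entries linear forms without case distinctions. *)
Definition entry_index : finType := ('I_n * 'I_n + 'I_n * 'I_m + 'I_p * 'I_n)%type.

Definition entry (e : entry_index) (T : V) : R :=
  match e with
  | inl (inl ij) => sym_mx T.1.1 ij.1 ij.2
  | inl (inr ij) => T.1.2 ij.1 ij.2
  | inr ij => T.2 ij.1 ij.2
  end.

Lemma entry_is_linear e : linear_for *:%R (entry e).
Proof. by case: e => [[ij|ij]|ij] a [[A B] C] [[A' B'] C']; rewrite /= !mxE. Qed.

HB.instance Definition _ e := GRing.isLinear.Build R V R *:%R (entry e)
  (@entry_is_linear e).

Lemma sym_mx_continuous : continuous (@sym_mx R n).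
Proof.
move=> A U /nbhs_ballP[e e0 sU]; apply/nbhs_ballP; exists e => // B AB.
by apply: sU; move: AB; rewrite -!ball_normE.
Qed.

Lemma entry_continuous e : continuous (entry e).
Proof.
case: e => [[ij|ij]|ij] T.
- apply: (@continuous_comp _ _ _ (fun T : V => sym_mx T.1.1) (fun M : 'M[R]_n => M ij.1 ij.2)).
    apply: (@continuous_comp _ _ _ (fun T : V => T.1.1) (@sym_mx R n)).
      apply: (@continuous_comp _ _ _ fst fst); exact: cvg_fst.
    exact: sym_mx_continuous.
  exact: coord_continuous.
- apply: (@continuous_comp _ _ _ (fun T : V => T.1.2) (fun M : 'M[R]_(n, m) => M ij.1 ij.2)).
    apply: (@continuous_comp _ _ _ fst snd); [exact: cvg_fst|exact: cvg_snd].
  exact: coord_continuous.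
- apply: (@continuous_comp _ _ _ snd (fun M : 'M[R]_(p, n) => M ij.1 ij.2)).
    exact: cvg_snd.
  exact: coord_continuous.
Qed.

Lemma nbhs_entries (T : V) (U : set V) : nbhs T U ->
  exists2 eps : R, 0 < eps &
    forall T', (forall e, `|entry e T - entry e T'| < eps) -> U T'.
Proof.
move=> /nbhs_ballP[eps /= e0 sU]; exists eps => // T' close; apply: sU.
have mx_ball a b (M M' : 'M[R]_(a, b)) :
    (forall i j, `|M i j - M' i j| < eps) -> ball M eps M'.
  move=> MM; rewrite -ball_normE /= /Num.norm /= mx_normrE.
  by apply/bigmax_ltP; split=> // ij _; rewrite !mxE.
split; first split.
- rewrite -ball_normE; have : ball (sym_mx T.1.1) eps (sym_mx T'.1.1).
    by apply: mx_ball => i j; exact: close (inl (inl (i, j))).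
  by rewrite -ball_normE.
- by apply: mx_ball => i j; exact: close (inl (inr (i, j))).
- by apply: mx_ball => i j; exact: close (inr (i, j)).
Qed.

(** Continuity into the ambient space, whose first factor carries the norm of
symmetric matrices, can thus be tested on real-valued functions. *)
Lemma continuous_entries (X : topologicalType) (f : X -> V) (x : X) :
  (forall e, {for x, continuous (entry e \o f)}) -> {for x, continuous f}.
Proof.
move=> cf U /nbhs_entries[eps e0 sU].
have close e : \forall y \near x, `|entry e (f x) - entry e (f y)| < eps.
  by have /cvgrPdist_lt/(_ eps e0) := cf e.
by apply: filterS (filter_forall _ close) => y; exact: sU.
Qed.

Definition rat_box (ab : {ffun entry_index -> rat * rat}) : set V :=
  [set T | forall e, ratr (ab e).1 < entry e T < ratr (ab e).2].

Lemma rat_box_open ab : open (rat_box ab).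
Proof.
rewrite openE => T Tab.
have key e : \forall T' \near T, ratr (ab e).1 < entry e T' < ratr (ab e).2.
  have /andP[lo hi] := Tab e; have ce := @entry_continuous e T.
  by apply: filterS2 (cvgr_gt _ ce _ lo) (cvgr_lt _ ce _ hi) => T' -> ->.
by apply: filterS (filter_forall _ key).
Qed.

Lemma rat_box_basis (T : V) (U : set V) : nbhs T U ->
  exists ab, rat_box ab T /\ rat_box ab `<=` U.
Proof.
move=> /nbhs_entries[eps e0 sU].
have /choice[ab abP] e : exists ab : rat * rat,
    (entry e T - eps < ratr ab.1 < entry e T) &&
    (entry e T < ratr ab.2 < entry e T + eps).
  have [|a aP] := @rat_in_itvoo R (entry e T - eps) (entry e T).
    by rewrite ltrBlDr ltrDl.
  have [|b bP] := @rat_in_itvoo R (entry e T) (entry e T + eps).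
    by rewrite ltrDl.
  by exists (a, b); move: aP bP; rewrite !in_itv /= => -> ->.
exists (finfun ab); split=> [e|T' T'ab].
  by rewrite ffunE; have /andP[/andP[_ ->] /andP[->]] := abP e.
apply: sU => e; move: (T'ab e); rewrite ffunE => /andP[lo hi].
have /andP[/andP[a1 a2] /andP[b1 b2]] := abP e.
by rewrite ltr_distlC; apply/andP; split; [apply: lt_trans lo|apply: lt_trans b2].
Qed.

Lemma triple_eqP (T T' : V) : (forall e, entry e T = entry e T') -> T = T'.
Proof.
case: T T' => [[A B] C] [[A' B'] C'] E; congr (_, _, _).
- by apply/val_inj/matrixP => i j; exact: E (inl (inl (i, j))).
- by apply/matrixP => i j; exact: E (inl (inr (i, j))).
- by apply/matrixP => i j; exact: E (inr (i, j)).
Qed.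

End Entries.

(** * Smoothness of the Gram-Schmidt frame *)

Section MatrixCk.
Context {R : realType} {V : normedModType R} (U : set V) (oU : open U).

(** Stated entrywise, so that only calculus of scalar functions is ever used. *)
Definition mxCk a b k (F : V -> 'M[R]_(a, b)) :=
  forall i j, Ck k U (fun x => F x i j).

Lemma mxCk_cst a b k (M : 'M[R]_(a, b)) : mxCk k (fun=> M).
Proof. by move=> i j; exact: (Ck_cst oU). Qed.

Lemma mxCkD a b k (F G : V -> 'M[R]_(a, b)) :
  mxCk k F -> mxCk k G -> mxCk k (fun x => F x + G x).
Proof.
move=> CF CG i j; apply: (Ck_ext oU (f := fun x => F x i j + G x i j)).
  by move=> x _; rewrite mxE.
exact: (CkD oU (CF i j) (CG i j)).
Qed.

Lemma mxCkZ a b k (c : V -> R) (F : V -> 'M[R]_(a, b)) :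
  Ck k U c -> mxCk k F -> mxCk k (fun x => c x *: F x).
Proof.
move=> Cc CF i j; apply: (Ck_ext oU (f := fun x => c x * F x i j)).
  by move=> x _; rewrite mxE.
exact: (CkM oU Cc (CF i j)).
Qed.

Lemma mxCkN a b k (F : V -> 'M[R]_(a, b)) :
  mxCk k F -> mxCk k (fun x => - F x).
Proof.
move=> CF i j; apply: (Ck_ext oU (f := fun x => (-1) * F x i j)).
  by move=> x _; rewrite mxE mulN1r.
apply: (CkM oU (f := fun=> -1)); [exact: (Ck_cst oU)|exact: CF].
Qed.

Lemma mxCkM a b c k (F : V -> 'M[R]_(a, b)) (G : V -> 'M[R]_(b, c)) :
  mxCk k F -> mxCk k G -> mxCk k (fun x => F x *m G x).
Proof.
move=> CF CG i j; apply: (Ck_ext oU (f := fun x => \sum_l F x i l * G x l j)).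
  by move=> x _; rewrite mxE.
by apply: (Ck_sum oU) => l; exact: (CkM oU (CF i l) (CG l j)).
Qed.

Lemma mxCkT a b k (F : V -> 'M[R]_(a, b)) :
  mxCk k F -> mxCk k (fun x => (F x)^T).
Proof.
move=> CF i j; apply: (Ck_ext oU (f := fun x => F x j i)) => //.
by move=> x _; rewrite mxE.
Qed.

Lemma mxCk_col a b k (l : 'I_b) (F : V -> 'M[R]_(a, b)) :
  mxCk k F -> mxCk k (fun x => col l (F x)).
Proof.
move=> CF i j; apply: (Ck_ext oU (f := fun x => F x i l)) => //.
by move=> x _; rewrite mxE.
Qed.

Lemma open_pos (f : V -> R) : Ck 0 U f -> open (U `&` [set x | 0 < f x]).
Proof.
move=> cf; rewrite openE => x [Ux fx].
have cx : f @ x --> f x := cf x Ux.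
by apply: filterS2 (open_nbhs_nbhs (conj oU Ux)) (cvgr_gt _ cx _ fx).
Qed.

End MatrixCk.

Section SmoothGramSchmidt.
Context {R : realType} {V : normedModType R} {n m : nat}.
Context (A : V -> 'M[R]_n) (B : V -> 'M[R]_(n, m)) (s : nat -> 'I_m + 'I_n).
Hypothesis CA : forall k, mxCk setT k A.
Hypothesis CB : forall k, mxCk setT k B.

Definition nondeg_dom k : set V := [set x | nondegenerate s (A x) (B x) k].

Lemma residual_Ck (U : set V) (P : V -> 'M[R]_n) x k : open U ->
  mxCk U k P -> mxCk U k (fun v => residual (A v) (B v) x (P v)).
Proof.
move=> oU CP.
have sub a b (F : V -> 'M[R]_(a, b)) : mxCk setT k F -> mxCk U k F.
  by move=> CF i j; apply: Ck_subset (CF i j).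
have Csrc : mxCk U k (fun v => krylov_src (A v) (B v) x (P v)).
  case: x => [j|i] /=; first exact/(mxCk_col oU)/sub.
  by apply: (mxCkM oU); [exact: sub|exact: (mxCk_col oU)].
apply: (mxCkD oU) => //; apply: (mxCkN oU); apply: (mxCkM oU) => //.
by apply: (mxCkM oU) => //; exact: (mxCkT oU).
Qed.

Lemma sqnorm_Ck (U : set V) (r : V -> 'cV[R]_n) k : open U ->
  mxCk U k r -> Ck k U (fun v => sqnorm (r v)).
Proof. by move=> oU Cr; apply: (mxCkM oU (mxCkT oU Cr) Cr). Qed.

(** Openness of the domain and smoothness go together by induction: the pivot of
step [k] is continuous on the set where the previous pivots are positive, and
its inverse square root is smooth where it is positive as well. *)
Lemma gram_schmidt_smooth k : open (nondeg_dom k) /\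
  forall q, mxCk (nondeg_dom k) q (fun x => gram_schmidt s (A x) (B x) k).
Proof.
elim: k => [|k [oD CP]].
  have -> : nondeg_dom 0 = setT by apply/seteqP; split.
  by split=> [|q]; [exact: openT|apply: (mxCk_cst openT)].
have domS : nondeg_dom k.+1 =
    nondeg_dom k `&` [set x | 0 < pivot s (A x) (B x) k].
  apply/seteqP; split=> x /= => [nd|[nd p] j].
    by split=> [j jk|]; apply: nd; rewrite ltnS // ltnW.
  by rewrite ltnS leq_eqVlt => /orP[/eqP ->//|/nd].
have Cr q := residual_Ck (s k) oD (CP q).
have oD' : open (nondeg_dom k.+1).
  rewrite domS; apply: (open_pos oD); exact: sqnorm_Ck (Cr 0%N).
split=> // q.
have sub a b (F : V -> 'M[R]_(a, b)) :
    mxCk (nondeg_dom k) q F -> mxCk (nondeg_dom k.+1) q F.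
  by move=> CF i j; apply: Ck_subset (CF i j); rewrite domS => x [].
apply: (mxCkD oD'); first exact/sub/CP.
apply: (mxCkZ oD'); last first.
  by apply: (mxCkM oD'); [exact/sub/Cr|exact: (mxCk_cst oD')].
apply: (Ck_rsqrt oD') => [x|]; first by rewrite domS => -[].
by apply: sqnorm_Ck => //; exact/sub/Cr.
Qed.

End SmoothGramSchmidt.

(** * The open invariant set N *)

Section OpenN.
Context {R : realType} {n m p : nat}.
Local Notation V := (triple R n m p).

Definition gs_domain s : set V := [set T : V | nondegenerate s T.1.1 T.1.2 n].

Lemma state_Ck k : mxCk setT k (fun T : V => sym_mx T.1.1).
Proof.
move=> i j; apply: (@Ck_linear R V R setT k (entry (inl (inl (i, j)))) openT).
exact: entry_continuous.
Qed.

Lemma input_Ck k : mxCk setT k (fun T : V => T.1.2).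
Proof.
move=> i j; apply: (@Ck_linear R V R setT k (entry (inl (inr (i, j)))) openT).
exact: entry_continuous.
Qed.

Lemma output_Ck k : mxCk setT k (fun T : V => T.2).
Proof.
move=> i j; apply: (@Ck_linear R V R setT k (entry (inr (i, j))) openT).
exact: entry_continuous.
Qed.

(** The quadratic form at [b y y *: x - b x y *: y] is nonnegative. *)
Lemma posdef_cauchy_schwarz (A : 'M[R]_n) (x y : 'cV[R]_n) : A^T = A -> posdef A ->
  (x^T *m A *m y) 0 0 ^+ 2 <= (x^T *m A *m x) 0 0 * (y^T *m A *m y) 0 0.
Proof.
move=> As Ap; pose b (u v : 'cV[R]_n) := (u^T *m A *m v) 0 0; rewrite -!/(b _ _).
have b_ge0 u : 0 <= b u u.
  have [->|u0] := eqVneq u 0; [by rewrite /b mulmx0 mxE lexx|exact/ltW/Ap].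
have bC u v : b u v = b v u.
  have -> : b u v = ((u^T *m A *m v)^T) 0 0 by rewrite [RHS]mxE.
  by rewrite !trmx_mul trmxK As mulmxA.
have b0 u : b u 0 = 0 by rewrite /b mulmx0 mxE.
have [->|y0] := eqVneq y 0; first by rewrite !b0 expr0n mulr0.
have byy : 0 < b y y := Ap _ y0.
have := b_ge0 (b y y *: x - b x y *: y).
have bL c d u v w : b (c *: u - d *: v) w = c * b u w - d * b v w.
  rewrite /b; have -> : (c *: u - d *: v)^T = c *: u^T - d *: v^T.
    by rewrite linearB /= !linearZ.
  rewrite !mulmxBl -!scalemxAl mxE [X in _ + X]mxE.
  by rewrite [X in X - _]mxE [X in _ - X]mxE.
rewrite bL bC bL (bC _ (_ - _)) bL (bC y x).
have -> : b y y * (b y y * b x x - b x y * b x y) -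
   b x y * (b y y * b x y - b x y * b y y) = b y y * (b x x * b y y - b x y ^+ 2) by ring.
by rewrite pmulr_rge0 // subr_ge0.
Qed.

(** The coordinate x_i is the A-inner product of x with the i-th column of the
inverse of A, so Cauchy-Schwarz for the form A bounds its square. *)
Lemma posdef_coercive (A : 'M[R]_n) : A^T = A -> posdef A ->
  exists2 c : R, 0 <= c & forall x : 'cV[R]_n,
    \sum_i x i 0 ^+ 2 <= c * (x^T *m A *m x) 0 0.
Proof.
move=> As Ap.
have Au : A \in unitmx.
  rewrite -row_free_unit; apply: inj_row_free => v vA; apply/eqP/negPn/negP => v0.
  have /Ap : v^T != 0 by rewrite -(inj_eq trmx_inj) trmxK trmx0.
  by rewrite trmxK vA mul0mx mxE ltxx.
pose u i : 'cV[R]_n := invmx A *m delta_mx i 0.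
pose q (x : 'cV[R]_n) := (x^T *m A *m x) 0 0.
have q_ge0 x : 0 <= q x.
  have [->|x0] := eqVneq x 0; [by rewrite /q mulmx0 mxE lexx|exact/ltW/Ap].
exists (\sum_i q (u i)) => [|x]; first by rewrite sumr_ge0.
rewrite mulr_suml; apply: ler_sum => i _.
suff -> : x i 0 = ((u i)^T *m A *m x) 0 0 by exact: posdef_cauchy_schwarz.
rewrite trmx_mul trmx_inv As -(mulmxA _ (invmx A)) mulVmx // mulmx1.
by rewrite trmx_delta -rowE mxE.
Qed.

(** Perturbing the entries of A by less than eps changes the form at x by at most
eps n |x|^2, which coercivity compares with the form itself. *)
Lemma posdef_open : open [set T : V | posdef T.1.1].
Proof.
rewrite openE => T Tp; have As := eqP (sym_mxP T.1.1).
have [c c0 cP] := posdef_coercive As Tp.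
(* eps n c = 1 - eps, so that a fraction eps of the form survives *)
pose eps : R := (c * n%:R + 1)^-1.
have e0 : 0 < eps by rewrite invr_gt0 ltr_wpDl // mulr_ge0.
have near_entries (ij : 'I_n * 'I_n) : \forall T' \near T,
    `|sym_mx T.1.1 ij.1 ij.2 - sym_mx T'.1.1 ij.1 ij.2| < eps.
  by have /cvgrPdist_lt/(_ eps e0) := @entry_continuous R n m p (inl (inl ij)) T.
apply: filterS (filter_forall _ near_entries) => T' close x x0 /=.
set A := sym_mx T.1.1 in As Tp cP close *; set A' := sym_mx T'.1.1 in close *.
have q0 := Tp x x0; set q := (x^T *m A *m x) 0 0 in q0.
have diffE : q - (x^T *m A' *m x) 0 0 = \sum_i \sum_j x i 0 * x j 0 * (A i j - A' i j).
  have -> : q - (x^T *m A' *m x) 0 0 = (x^T *m (A - A') *m x) 0 0.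
    by rewrite mulmxBr mulmxBl [RHS]mxE [X in _ = _ + X]mxE.
  rewrite mxE exchange_big /=; apply: eq_bigr => j _.
  rewrite mxE mulr_suml; apply: eq_bigr => i _; rewrite !mxE; ring.
have bound : q - (x^T *m A' *m x) 0 0 <= eps * n%:R * \sum_i x i 0 ^+ 2.
  have -> : eps * n%:R * \sum_i x i 0 ^+ 2 =
      \sum_i \sum_j eps * ((x i 0 ^+ 2 + x j 0 ^+ 2) / 2).
    have E1 : \sum_(i < n) \sum_(j < n) x i 0 ^+ 2 = n%:R * \sum_i x i 0 ^+ 2.
      rewrite mulr_sumr; apply: eq_bigr => i _.
      by rewrite sumr_const card_ord mulr_natl.
    have E2 : \sum_(i < n) \sum_(j < n) x j 0 ^+ 2 = n%:R * \sum_i x i 0 ^+ 2.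
      by rewrite exchange_big.
    under [RHS]eq_bigr do rewrite -mulr_sumr -mulr_suml big_split /=.
    rewrite -mulr_sumr -mulr_suml big_split /= E1 E2 -mulrA; congr (_ * _).
    by field.
  rewrite diffE; apply: ler_sum => i _; apply: ler_sum => j _.
  (* |x_i x_j| <= (x_i^2 + x_j^2) / 2 *)
  have := close (i, j) => /= /ltr_normlP[l1 l2].
  have sq1 := sqr_ge0 (x i 0 - x j 0); have sq2 := sqr_ge0 (x i 0 + x j 0).
  nra.
have cq := cP x; rewrite -/q in cq.
have : eps * n%:R * \sum_i x i 0 ^+ 2 <= eps * n%:R * (c * q).
  by rewrite ler_wpM2l // mulr_ge0 // ltW.
have -> : eps * n%:R * (c * q) = q - eps * q.
  have eE : eps * (c * n%:R + 1) = 1 by rewrite mulVf // gt_eqF // ltr_wpDl // mulr_ge0.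
  transitivity (eps * (c * n%:R + 1) * q - eps * q); first by ring.
  by rewrite eE mul1r.
have eq0 : 0 < eps * q by rewrite mulr_gt0.
move=> h; lra.
Qed.

(** Controllability and observability are unions of the open sets on which some
Gram-Schmidt process succeeds; observability is controllability of the
transposed pair. *)
Lemma N_open : (0 < n)%N -> open (N R n m p).
Proof.
move=> n0.
have -> : N R n m p = [set T : V | posdef T.1.1] `&`
   ((\bigcup_s gs_domain s) `&` \bigcup_s nondeg_dom (fun T : V => (sym_mx T.1.1)^T)
      (fun T : V => T.2^T) s n).
  apply/seteqP; split=> T /= [Tp].
    move=> cT /observable_tr oT; split=> //; split.
      by have [s sP] := controllable_nondegenerate n0 cT; exists s.
    by have [s sP] := controllable_nondegenerate n0 oT; exists s.
  move=> [[s _ sP] [s' _ sP']]; split=> //; first exact: nondegenerate_controllable sP.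
  by apply/observable_tr; exact: nondegenerate_controllable sP'.
apply: openI; first exact: posdef_open.
apply: openI; apply: bigcup_open => s _.
  by have [] := gram_schmidt_smooth s state_Ck input_Ck n.
have [|k|//] := @gram_schmidt_smooth R V n p (fun T : V => (sym_mx T.1.1)^T)
      (fun T : V => T.2^T) s _ _ n.
  by move=> k; apply: (mxCkT openT); exact: state_Ck.
by apply: (mxCkT openT); exact: output_Ck.
Qed.

Lemma act_N (U : 'M[R]_n) (T : V) : (0 < n)%N -> orthogonal_mx U ->
  N R n m p T -> N R n m p (act U T).
Proof.
move=> n0 oU [Tp Tc To]; have oU' := mulmx1C oU; split.
- move=> x x0; have /Tp : U *m x != 0.
    by apply: contra_neq x0 => Ux; rewrite -[x]mul1mx -oU -mulmxA Ux mulmx0.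
  by rewrite trmx_mul !mulmxA.
- have [s sP] := controllable_nondegenerate n0 Tc.
  apply: (@nondegenerate_controllable _ _ _ s) => k kn.
  by rewrite /= pivot_invariant //; exact: sP.
- move/observable_tr: To => To; have [s sP] := controllable_nondegenerate n0 To.
  apply/observable_tr; apply: (@nondegenerate_controllable _ _ _ s) => k kn /=.
  by rewrite !trmx_mul trmxK mulmxA pivot_invariant //; exact: sP.
Qed.

End OpenN.

(** * Coordinates on the slices *)

Section SliceCoordinates.
Context {R : realType} {n m p : nat}.
Local Notation V := (triple R n m p).
Local Notation E := (@entry_index n m p).
Implicit Types s : nat -> 'I_m + 'I_n.

Definition normal_form s (T : V) : V :=
  act (gram_schmidt s T.1.1 T.1.2 n) T.

(** The representative, on or below the diagonal, of a pair of symmetric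
positions. *)
Definition lower (e : E) : E :=
  match e with
  | inl (inl (i, j)) => if (j <= i)%N then inl (inl (i, j)) else inl (inl (j, i))
  | _ => e
  end.

(** The position of row [l] in the column examined at step [k]. *)
Definition src_entry s (k l : 'I_n) : E :=
  match s k with inl j => inl (inr (l, j)) | inr i => inl (inl (l, i)) end.

Definition lower_entries : {set E} := [set e | lower e == e]%SET.

Definition lt_pairs : {set 'I_n * 'I_n} := [set kl : 'I_n * 'I_n | (kl.1 < kl.2)%N]%SET.

Definition vanishing_entries s : {set E} := [set src_entry s kl.1 kl.2 | kl in lt_pairs]%SET.

Definition free_entries s : {set E} := (lower_entries :\: vanishing_entries s)%SET.

Definition quotient_dim : nat := #|lower_entries| - #|lt_pairs|.

Lemma lower_idem e : lower (lower e) = lower e.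
Proof.
case: e => [[[i j]|ij]|ij] //=; case: leqP => ij /=; first by rewrite ij.
by rewrite ltnW.
Qed.

Lemma lower_swap (i j : 'I_n) : lower (inl (inl (i, j))) = lower (inl (inl (j, i))).
Proof. by rewrite /=; case: ltngtP => // /val_inj ->. Qed.

Lemma entry_lower e (T : V) : entry (lower e) T = entry e T.
Proof.
case: e => [[[i j]|ij]|ij] //=; case: leqP => //= ij.
by rewrite -[in RHS](eqP (sym_mxP T.1.1)) mxE.
Qed.

Lemma src_entryE s (k l : 'I_n) (T : V) :
  entry (src_entry s k l) T = slice_col T.1.1 T.1.2 (s k) l 0.
Proof. by rewrite /src_entry; case: (s k) => x /=; rewrite mxE. Qed.

Lemma lower_src_entry s (k l : 'I_n) : admissible s -> (k <= l)%N ->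
  lower (src_entry s k l) = src_entry s k l.
Proof.
move=> [_ sk] kl; rewrite /src_entry; case ske: (s k) => [//|i] /=.
by rewrite ltnW // (leq_trans (sk _ _ ske)).
Qed.

(** The positions forced to vanish are pairwise distinct: a position determines its
row and the column examined, and [s] repeats no column.  So their number is that
of the pairs k < l, for every [s]. *)
Lemma card_free_entries s : admissible s -> #|free_entries s| = quotient_dim.
Proof.
move=> adm; have [sinj _] := adm; rewrite cardsD; congr (_ - _)%N.
have /finset.setIidPr -> : (vanishing_entries s \subset lower_entries)%SET.
  apply/fintype.subsetP => e /imsetP[[k l]]; rewrite !inE /= => kl ->.
  by rewrite lower_src_entry // ltnW.
apply: card_imset => -[k l] [k' l']; rewrite /src_entry /=.
case ek: (s k) => [j|i]; case ek': (s k') => [j'|i'] // [-> e].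
  by congr (_, _); apply: sinj; rewrite ek ek' e.
by congr (_, _); apply: sinj; rewrite ek ek' e.
Qed.

Context {d : nat}.
Implicit Types f : 'I_d -> E.

(** A numbering of the free positions; the number [d] of coordinates is kept
abstract so that charts for different [s] share one model space. *)
Definition framing s f := injective f /\ forall e, (e \in free_entries s) = (e \in codom f).

Definition coords f (T : V) : 'rV[R]_d := \row_i entry (f i) T.

(** The entry at [e] of the triple with coordinates [y]: the coordinate numbered by
the lower representative of [e], and zero when that position is not free. *)
Definition entry_from_coords f (y : 'rV[R]_d) (e : E) : R :=
  \sum_i y 0 i * (f i == lower e)%:R.

Lemma entry_from_coords_symmetric f y :
  (\matrix_(i, j) entry_from_coords f y (inl (inl (i, j))) : 'M[R]_n) \is a symmx.
Proof.
rewrite qualifE /= /symmx_pred; apply/eqP/matrixP => i j; rewrite !mxE /entry_from_coords.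
by rewrite lower_swap.
Qed.

Definition assemble f (y : 'rV[R]_d) : V :=
  (Sym (entry_from_coords_symmetric f y), \matrix_(i, j) entry_from_coords f y (inl (inr (i, j))),
   \matrix_(i, j) entry_from_coords f y (inr (i, j))).

Lemma entry_assemble f y e : entry e (assemble f y) = entry_from_coords f y e.
Proof. by case: e => [[[i j]|[i j]]|[i j]]; rewrite /= mxE. Qed.

Lemma assemble_is_linear f : linear (assemble f).
Proof.
move=> a y z; apply: triple_eqP => e; rewrite linearP /= !entry_assemble /entry_from_coords.
rewrite scaler_sumr -big_split /=; apply: eq_bigr => i _.
by rewrite !mxE mulrDl scalerAl.
Qed.

HB.instance Definition _ f :=
  GRing.isLinear.Build R 'rV[R]_d V *:%R (assemble f) (assemble_is_linear f).

Lemma assemble_continuous f : continuous (assemble f).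
Proof.
move=> y; apply: continuous_entries => e.
have -> : entry e \o assemble f = fun y => \sum_i y 0 i * (f i == lower e)%:R.
  by apply/funext => z; exact: entry_assemble.
suff: Ck 0 setT (fun y : 'rV[R]_d => \sum_i y 0 i * (f i == lower e)%:R) by exact.
apply: (Ck_sum openT) => i; apply: (CkM openT); last exact: (Ck_cst openT).
by move=> z _; exact: coord_continuous.
Qed.

Lemma coords_assemble s f y : framing s f -> coords f (assemble f y) = y.
Proof.
move=> [finj fE]; apply/rowP => i; rewrite mxE entry_assemble /entry_from_coords.
have : f i \in free_entries s by rewrite fE codom_f.
rewrite !inE => /andP[_ /eqP ->].
rewrite (bigD1 i) //= big1 => [|j ji]; first by rewrite eqxx mulr1 addr0.
by rewrite (inj_eq finj) (negPf ji) mulr0.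
Qed.

Lemma assemble_coords s f (T : V) : framing s f ->
  (forall k l : 'I_n, (k < l)%N -> slice_col T.1.1 T.1.2 (s k) l 0 = 0) ->
  assemble f (coords f T) = T.
Proof.
move=> [finj fE] sl; apply: triple_eqP => e; rewrite entry_assemble /entry_from_coords.
rewrite -entry_lower; have [|eN] := boolP (lower e \in free_entries s).
  rewrite fE => /codomP[i ei].
  rewrite (bigD1 i) //= big1 => [|j ji]; first by rewrite ei eqxx mulr1 addr0 mxE.
  by rewrite ei (inj_eq finj) (negPf ji) mulr0.
rewrite big1 => [|i _]; last first.
  have [fi|_] := eqVneq; last by rewrite mulr0.
  by move: eN; rewrite -fi fE codom_f.
move: eN; rewrite !inE lower_idem eqxx andbT negbK => /imsetP[[k l]].
by rewrite inE /= => kl ->; rewrite src_entryE sl.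
Qed.

Lemma framed_zeros s f y (k l : 'I_n) : admissible s -> framing s f -> (k < l)%N ->
  slice_col (assemble f y).1.1 (assemble f y).1.2 (s k) l 0 = 0.
Proof.
move=> adm [finj fE] kl; rewrite -src_entryE entry_assemble /entry_from_coords big1 // => i _.
rewrite lower_src_entry ?(ltnW kl) //; case: eqVneq => [fi|_]; last by rewrite mulr0.
have : f i \in free_entries s by rewrite fE codom_f.
rewrite !inE fi => /andP[/negP[]]; apply/imsetP; exists (k, l) => //.
by rewrite inE.
Qed.

Definition slice_coords s f : set 'rV[R]_d :=
  [set y | forall k : 'I_n, 0 < entry (src_entry s k k) (assemble f y)].

Lemma slice_coords_open s f : open (slice_coords s f).
Proof.
rewrite openE => y y0.
have key (k : 'I_n) : \forall z \near y, 0 < entry (src_entry s k k) (assemble f z).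
  have c : {for y, continuous (entry (src_entry s k k) \o assemble f)}.
    apply: continuous_comp; first exact: assemble_continuous.
    exact: entry_continuous.
  exact: (cvgr_gt _ c _ (y0 k)).
by apply: filterS (filter_forall _ key).
Qed.

(** The charts of the quotient, expressed on triples. *)
Definition slice_map s f (T : V) : 'rV[R]_d := coords f (normal_form s T).

Lemma assemble_slice_map s f (T : V) : framing s f -> gs_domain s T ->
  assemble f (slice_map s f T) = normal_form s T.
Proof.
move=> fr sT; apply: (assemble_coords fr) => k l kl.
by have [_ /(_ k)[_]] := gram_schmidt_in_slice sT; exact.
Qed.

Lemma slice_map_coords s f (T : V) : framing s f -> gs_domain s T ->
  slice_coords s f (slice_map s f T).
Proof.
move=> fr sT k; rewrite assemble_slice_map // src_entryE.
by have [_ /(_ k)[]] := gram_schmidt_in_slice sT.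
Qed.

Lemma assemble_dom s f y : admissible s -> framing s f -> slice_coords s f y ->
  gs_domain s (assemble f y) /\ normal_form s (assemble f y) = assemble f y.
Proof.
move=> adm fr y0.
have sl : in_slice s (assemble f y).1.1 (assemble f y).1.2.
  by move=> k; split=> [|l kl]; [rewrite -src_entryE; exact: y0|exact: framed_zeros].
have [Pn nd] := slice_gram_schmidt adm sl (leqnn n); split=> //.
by rewrite /normal_form Pn trunc_mxn act1.
Qed.

Lemma slice_map_assemble s f y : admissible s -> framing s f -> slice_coords s f y ->
  slice_map s f (assemble f y) = y.
Proof.
move=> adm fr y0; rewrite /slice_map (assemble_dom adm fr y0).2.
exact: coords_assemble fr.
Qed.

Lemma gs_domain_act s (U : 'M[R]_n) (T : V) :
  orthogonal_mx U -> gs_domain s T -> gs_domain s (act U T).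
Proof. by move=> oU sT k kn; rewrite /= pivot_invariant //; exact: sT. Qed.

Lemma normal_form_act s (U : 'M[R]_n) (T : V) : orthogonal_mx U ->
  normal_form s (act U T) = normal_form s T.
Proof.
move=> oU; rewrite /normal_form actM /= gram_schmidt_equivariant // mulmxA.
by rewrite (mulmx1C oU) mul1mx.
Qed.

Lemma gs_domain_open s : open (gs_domain s : set V).
Proof. by have [] := gram_schmidt_smooth s (@state_Ck R n m p) (@input_Ck R n m p) n. Qed.

Lemma slice_map_Ck s f k : Ck k (gs_domain s) (slice_map s f).
Proof.
have oD := @gs_domain_open s.
have [_ /(_ k) CQ] := gram_schmidt_smooth s (@state_Ck R n m p) (@input_Ck R n m p) n.
have sub a b (F : V -> 'M[R]_(a, b)) : mxCk setT k F -> mxCk (gs_domain s) k F.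
  by move=> CF i j; apply: Ck_subset (CF i j).
have Ce e : Ck k (gs_domain s) (fun T => entry e (normal_form s T)).
  case: e => [[[i j]|[i j]]|[i j]] /=.
  - apply: (mxCkM oD _ CQ); apply: (mxCkM oD); first exact: (mxCkT oD CQ).
    exact/sub/state_Ck.
  - by apply: (mxCkM oD (mxCkT oD CQ)); exact/sub/input_Ck.
  - by apply: (mxCkM oD _ CQ); exact/sub/output_Ck.
apply: (Ck_ext oD (f := fun T => \sum_i entry (f i) (normal_form s T) *: delta_mx 0 i)).
  move=> T _; rewrite [RHS]row_sum_delta; apply: eq_bigr => i _.
  by rewrite [X in _ = X *: _]mxE.
by apply: (Ck_sum oD) => i; apply: (CkZl oD); exact: Ce.
Qed.

End SliceCoordinates.

Lemma exists_framing n m p (s : nat -> 'I_m + 'I_n) : admissible s ->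
  exists f : 'I_(@quotient_dim n m p) -> @entry_index n m p, framing s f.
Proof.
move=> /(@card_free_entries n m p) cE.
exists (fun i => enum_val (cast_ord (esym cE) i)); split.
  by move=> i j /enum_val_inj/cast_ord_inj.
move=> e; apply/idP/codomP => [eF|[i ->]]; last exact: enum_valP.
by exists (cast_ord cE (enum_rank_in eF e)); rewrite cast_ordK enum_rankK_in.
Qed.


(** * Invariants separate the orbits *)

Section Invariants.
Context {R : realType} {n m p : nat}.
Local Notation V := (triple R n m p).

Definition markov a (D : 'M[R]_(a, n)) (A : 'M[R]_n) (B : 'M[R]_(n, m)) c :=
  D *m iter c (mulmx A) B.

Lemma markov_act a (D : 'M[R]_(a, n)) A B c (U : 'M[R]_n) : orthogonal_mx U ->
  markov (D *m U) (U^T *m A *m U) (U^T *m B) c = markov D A B c.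
Proof.
move=> /mulmx1C oU; rewrite /markov.
have -> : iter c (mulmx (U^T *m A *m U)) (U^T *m B) = U^T *m iter c (mulmx A) B.
  by elim: c => //= c ->; rewrite -!mulmxA (mulmxA U) oU mul1mx.
by rewrite !mulmxA -(mulmxA D) oU mulmx1.
Qed.

Lemma markov_Ck a (D : V -> 'M[R]_(a, n)) c : mxCk setT 0 D ->
  mxCk setT 0 (fun T : V => markov (D T) T.1.1 T.1.2 c).
Proof.
move=> CD; apply: (mxCkM openT CD); elim: c => [|c IH]; first exact: input_Ck.
exact: (mxCkM openT (@state_Ck R n m p 0) IH).
Qed.

Section Pairs.
Variables (A A' : 'M[R]_n) (B B' : 'M[R]_(n, m)).

(** Pairs of vectors obtained from (A, B) and (A', B') by one and the same formula. *)
Inductive krylov_pair : 'cV[R]_n -> 'cV[R]_n -> Prop :=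
| krylov_pair_col j : krylov_pair (col j B) (col j B')
| krylov_pair_mul u u' : krylov_pair u u' -> krylov_pair (A *m u) (A' *m u')
| krylov_pair0 : krylov_pair 0 0
| krylov_pairP a u u' v v' : krylov_pair u u' -> krylov_pair v v' ->
    krylov_pair (a *: u + v) (a *: u' + v').

Lemma krylov_pair_mulmx (P P' : 'M[R]_n) (w : 'cV[R]_n) :
  (forall i, krylov_pair (col i P) (col i P')) ->
  krylov_pair (P *m w) (P' *m w).
Proof.
move=> PP.
have E (M : 'M[R]_n) : M *m w = \sum_i w i 0 *: col i M.
  apply/colP => j; rewrite summxE mxE; apply: eq_bigr => i _.
  by rewrite !mxE mulrC.
rewrite !E; elim: (index_enum _) => [|i r IH].
  by rewrite !big_nil; exact: krylov_pair0.
by rewrite !big_cons; exact: krylov_pairP.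
Qed.

(** The coefficients that Gram-Schmidt uses for (A, B) can be used for (A', B') as
well; the resulting vectors need not be those of Gram-Schmidt for (A', B'). *)
Lemma krylov_pair_gram_schmidt s k :
  exists P', forall i, krylov_pair (col i (gram_schmidt s A B k)) (col i P').
Proof.
elim: k => [|k [P' PP]].
  by exists 0 => i; rewrite /= !linear0; exact: krylov_pair0.
set P := gram_schmidt s A B k in PP.
have Psrc : krylov_pair (krylov_src A B (s k) P) (krylov_src A' B' (s k) P').
  by case: (s k) => [j|i] /=; [exact: krylov_pair_col|exact: krylov_pair_mul].
pose w := P^T *m krylov_src A B (s k) P.
pose r' := krylov_src A' B' (s k) P' - P' *m w.
have Pr : krylov_pair (residual A B (s k) P) r'.
  have subE (u v : 'cV[R]_n) : u - v = (-1) *: v + u by rewrite scaleN1r addrC.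
  rewrite /residual /r' -/w !subE; apply: krylov_pairP => //.
  exact: krylov_pair_mulmx.
pose c := rsqrt (sqnorm (residual A B (s k) P)).
exists (P' + c *: (r' *m unit_row k)) => i.
have E (M : 'M[R]_n) (r : 'cV[R]_n) :
    col i (M + c *: (r *m unit_row k)) = (c * unit_row k 0 i) *: r + col i M.
  by apply/colP => j; rewrite !mxE big_ord1 !mxE addrC -mulrA [_%:R * _]mulrC.
by rewrite /= !E; exact: krylov_pairP.
Qed.

Lemma krylov_pair_markov a (D D' : 'M[R]_(a, n)) u u' c :
  (forall c, markov D A B c = markov D' A' B' c) -> krylov_pair u u' ->
  D *m iter c (mulmx A) u = D' *m iter c (mulmx A') u'.
Proof.
have iterL (M : 'M[R]_n) b x y d :
    iter d (mulmx M) (b *: x + y : 'cV[R]_n) =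
    b *: iter d (mulmx M) x + iter d (mulmx M) y.
  by elim: d => //= d ->; rewrite mulmxDr -scalemxAr.
move=> DD uu; elim: uu c => [j|v v' _ IH||b v v' w w' _ IHv _ IHw] c.
- have iterC (M : 'M[R]_n) (X : 'M[R]_(n, m)) :
      iter c (mulmx M) (col j X) = col j (iter c (mulmx M) X).
    by elim: c => //= c ->; rewrite !colE mulmxA.
  by rewrite !iterC !colE !mulmxA; congr (_ *m _); exact: DD.
- by have := IH c.+1; rewrite !iterSr.
- have iter0 (M : 'M[R]_n) : iter c (mulmx M) (0 : 'cV[R]_n) = 0.
    by elim: c => //= c ->; rewrite mulmx0.
  by rewrite !iter0 !mulmx0.
- by rewrite !iterL !mulmxDr -!scalemxAr IHv IHw.
Qed.

(** Inner products of corresponding vectors are combinations of Markov parameters: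
move the powers of A from the left factor to the right one by symmetry. *)
Lemma krylov_pair_dot u u' v v' : A^T = A -> A'^T = A' ->
  (forall c, markov B^T A B c = markov B'^T A' B' c) ->
  krylov_pair u u' -> krylov_pair v v' -> u^T *m v = u'^T *m v'.
Proof.
move=> As As' BB uu; elim: uu v v' => [j|x x' _ IH||b x x' y y' _ IHx _ IHy] v v' vv.
- rewrite !tr_col !rowE -!mulmxA; congr (_ *m _).
  exact: (krylov_pair_markov 0 BB vv).
- by rewrite !trmx_mul As As' -!mulmxA; apply: IH; exact: krylov_pair_mul.
- by rewrite !trmx0 !mul0mx.
- rewrite ![(_ + _)^T]linearD /= ![(_ *: _)^T]linearZ /= !mulmxDl -!scalemxAl.
  by rewrite (IHx _ _ vv) (IHy _ _ vv).
Qed.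

End Pairs.

(** Apply to the second triple the formulas that build Q for the first one.  The
resulting matrix Q' has the same Gram matrix as Q, so it is orthogonal too, and
the two triples have the same expression in the bases Q and Q'. *)
Lemma markov_separates s (T T' : V) : gs_domain s T ->
  (forall c, markov T.1.2^T T.1.1 T.1.2 c = markov T'.1.2^T T'.1.1 T'.1.2 c) ->
  (forall c, markov T.2 T.1.1 T.1.2 c = markov T'.2 T'.1.1 T'.1.2 c) ->
  exists2 U : 'M[R]_n, orthogonal_mx U & T' = act U T.
Proof.
case: T T' => [[A B] C] [[A' B'] C'] /= sT BB CC.
have [Q' QQ] := krylov_pair_gram_schmidt A A' B B' s n.
set Q := gram_schmidt s A B n in QQ.
have oQ : orthogonal_mx Q := orthogonal_gram_schmidt sT.
have As := eqP (sym_mxP A); have As' := eqP (sym_mxP A').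
have dot := krylov_pair_dot As As' BB.
have entriesE a (X X' : 'M[R]_(a, n)) q (Y Y' : 'M[R]_(n, q)) :
    (forall i j, row i X *m col j Y = row i X' *m col j Y') ->
    X *m Y = X' *m Y'.
  move=> XY; apply/matrixP => i j; have /matrixP/(_ 0 0) := XY i j; rewrite !mxE.
  by under eq_bigr do rewrite !mxE; move=> ->; apply: eq_bigr => l _; rewrite !mxE.
have gram : Q^T *m Q = Q'^T *m Q'.
  by apply: entriesE => i j; rewrite -!tr_col; exact: dot.
have oQ' : orthogonal_mx Q' by rewrite /orthogonal_mx -gram.
have stateE : Q^T *m A *m Q = Q'^T *m A' *m Q'.
  rewrite -!mulmxA; apply: entriesE => i j; rewrite -!tr_col !colE -!mulmxA -!colE.
  by apply: dot => //; exact: krylov_pair_mul.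
have inputE : Q^T *m B = Q'^T *m B'.
  by apply: entriesE => i j; rewrite -!tr_col; apply: dot => //; exact: krylov_pair_col.
have outputE : C *m Q = C' *m Q'.
  apply: entriesE => i j; rewrite !rowE -!mulmxA; congr (_ *m _).
  exact: (krylov_pair_markov 0 CC (QQ j)).
exists (Q *m Q'^T).
  by rewrite /orthogonal_mx trmx_mul trmxK mulmxA -(mulmxA Q') oQ mulmx1 mulmx1C.
have -> : (A', B', C') = act Q'^T (act Q' (A', B', C')).
  by rewrite actM (mulmx1C oQ') act1.
rewrite -actM; congr (act _ _); rewrite /act /= -inputE -outputE.
by congr (_, _, _); apply: val_inj; rewrite /= stateE.
Qed.

End Invariants.

(** * The quotient manifold *)

Lemma coord_mapE (R : realType) (Y Z : topologicalType) (E F : normedModType R) (z0 z : Y)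
    (phi : chart Y E) (psi : chart Z F) (g : Y -> Z) :
  {in chart_dom phi &, injective phi} -> chart_dom phi z ->
  coord_map z0 phi psi g (phi z) = psi (g z).
Proof.
by move=> inj sz; rewrite /coord_map /= pinvKV ?inE.
Qed.

Section QuotientManifold.
Context {R : realType} {n m p : nat} (n0 : (0 < n)%N).
Local Notation V := (triple R n m p).
Local Notation NT := (set_type (N R n m p)).
Local Notation X := (N_mod_O R n m p).
Local Notation pi := (@N_proj R n m p).
Implicit Types s : nat -> 'I_m + 'I_n.

Lemma N_proj_repr (x : X) : pi (repr x) = x.
Proof. exact: reprK. Qed.

Lemma N_projP (T T' : NT) : pi T = pi T' <->
  exists2 U : 'M[R]_n, orthogonal_mx U & set_val T' = act U (set_val T).
Proof.
split=> [/(@eqmodP _ _ T T')/asboolP//|[U oU TU]].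
by apply/(@eqmodP _ _ T T')/asboolP; exists U.
Qed.

Lemma repr_proj (T : NT) : exists2 U : 'M[R]_n, orthogonal_mx U &
  set_val (repr (pi T)) = act U (set_val T).
Proof. by apply/N_projP; rewrite N_proj_repr. Qed.

Lemma open_quotientE (O : set X) : open O = open (pi @^-1` O).
Proof. by []. Qed.

Lemma set_val_continuous : continuous (set_val : NT -> V).
Proof. exact: initial_continuous. Qed.

Lemma N_proj_continuous : continuous pi.
Proof. exact: pi_continuous. Qed.

Lemma set_valN (T : NT) : N R n m p (set_val T).
Proof. exact: set_valP. Qed.

Lemma N_lift (T : V) : N R n m p T -> exists T' : NT, set_val T' = T.
Proof. by move=> NTT; exists (exist _ T (mem_set NTT)). Qed.

Lemma set_val_open (O : set NT) : open O -> open (set_val @` O : set V).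
Proof.
move=> [W oW <-]; rewrite (_ : _ @` _ = W `&` N R n m p).
  by apply: openI => //; exact: N_open.
apply/seteqP; split=> [_ [T WT <-]|T [WT /N_lift[T' T'T]]].
  by split=> //; exact: set_valN.
by exists T' => //=; rewrite T'T.
Qed.

Lemma act_is_linear (U : 'M[R]_n) : linear (act U : V -> V).
Proof.
move=> a [[A B] C] [[A' B'] C']; congr (_, _, _).
- by apply: val_inj; rewrite /= mulmxDr mulmxDl -scalemxAr -scalemxAl.
- by rewrite /= mulmxDr -scalemxAr.
- by rewrite /= mulmxDl -scalemxAl.
Qed.

HB.instance Definition _ (U : 'M[R]_n) :=
  GRing.isLinear.Build R V V *:%R (act U) (act_is_linear U).

Lemma act_continuous (U : 'M[R]_n) : continuous (act U : V -> V).
Proof.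
move=> T; apply: continuous_entries => e.
suff Ce k : Ck k setT (fun T : V => entry e (act U T)) by exact: (Ce 0%N).
have cst a b (M : 'M[R]_(a, b)) : mxCk setT k (fun _ : V => M).
  exact: (@mxCk_cst R V setT openT a b k M).
case: e => [[[i j]|[i j]]|[i j]] /=.
- apply: (mxCkM openT _ (cst _ _ U)).
  exact: (mxCkM openT (cst _ _ U^T) (@state_Ck R n m p k)).
- exact: (mxCkM openT (cst _ _ U^T) (@input_Ck R n m p k) i j).
- exact: (mxCkM openT (@output_Ck R n m p k) (cst _ _ U) i j).
Qed.

(** The saturation of an open set is the union of its images under the group. *)
Lemma N_proj_open (O : set NT) : open O -> open (pi @` O).
Proof.
move=> oO; rewrite open_quotientE.
have -> : pi @^-1` (pi @` O) =
    \bigcup_(U in [set U : 'M[R]_n | orthogonal_mx U])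
      (set_val @^-1` (act U @^-1` (set_val @` O)) : set NT).
  apply/seteqP; split=> [T [T' OT' /esym/N_projP[U oU TU]]|T [U oU [T' OT' TT']]].
    by exists U => //; exists T'.
  by exists T' => //; apply/esym/N_projP; exists U.
apply: bigcup_open => U _; apply: open_comp => [T _|]; first exact: set_val_continuous.
apply: open_comp => [T _|]; first exact: act_continuous.
exact: set_val_open.
Qed.

(** Points that cannot be separated have the same values under all continuous
invariants, in particular under the Markov parameters. *)
Lemma quotient_hausdorff : hausdorff_space X.
Proof.
move=> x y xy.
have same (g : V -> R) : (forall U T, orthogonal_mx U -> g (act U T) = g T) ->
    continuous g -> g (set_val (repr x)) = g (set_val (repr y)).
  move=> gU cg; pose h (z : X) := g (set_val (repr z)).
  have ch : continuous h.
    apply/quotient_continuous; suff: continuous (h \o pi) by exact.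
    have -> : h \o pi = g \o set_val.
      by apply/funext => T; rewrite /h /=; have [U oU ->] := repr_proj T; rewrite gU.
    by move=> T; apply: continuous_comp; [exact: set_val_continuous|exact: cg].
  apply: (@Rhausdorff R) => P Q nP nQ.
  have [z [Pz Qz]] := xy _ _ (ch x _ nP) (ch y _ nQ).
  by exists (h z).
have [_ cT _] := set_valN (repr x).
have [s sT] := controllable_nondegenerate n0 cT.
have [c|c|U oU TU] := @markov_separates R n m p s (set_val (repr x)) (set_val (repr y)) sT.
- apply/matrixP => i j; apply: (same (fun T => markov T.1.2^T T.1.1 T.1.2 c i j)).
    by move=> U T oU; rewrite /= trmx_mul trmxK markov_act.
  suff: Ck 0 setT (fun T : V => markov T.1.2^T T.1.1 T.1.2 c i j).
    by move=> cc T; exact: cc.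
  by apply: markov_Ck; apply: (mxCkT openT); exact: input_Ck.
- apply/matrixP => i j; apply: (same (fun T => markov T.2 T.1.1 T.1.2 c i j)).
    by move=> U T oU; rewrite /= markov_act.
  suff: Ck 0 setT (fun T : V => markov T.2 T.1.1 T.1.2 c i j).
    by move=> cc T; exact: cc.
  by apply: markov_Ck; exact: output_Ck.
- by rewrite -(N_proj_repr x) -(N_proj_repr y); apply/N_projP; exists U.
Qed.

(** The images of the rational boxes form a basis, the projection being open. *)
Lemma quotient_second_countable : @second_countable X.
Proof.
pose box ab : set X := pi @` (set_val @^-1` rat_box ab : set NT).
exists (range box); first exact: sub_countable (card_image_le _ _) (countableP _).
split=> [_ [ab _ <-]|x U].
  apply: N_proj_open; apply: open_comp; last exact: rat_box_open.
  by move=> T _; exact: set_val_continuous.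
rewrite nbhsE => [[G [oO Ox] OU]].
have oW : open (set_val @` (pi @^-1` G)) by apply: set_val_open.
have Wx : (set_val @` (pi @^-1` G)) (set_val (repr x)).
  by exists (repr x) => //=; rewrite N_proj_repr.
have [ab [abx abW]] := rat_box_basis (open_nbhs_nbhs (conj oW Wx)).
exists (box ab).
  split; first by exists ab.
  by exists (repr x) => //; exact: N_proj_repr.
move=> _ [T /abW [T' OT' /val_inj TT'] <-]; apply: OU.
by rewrite -TT'.
Qed.

Context {d : nat}.
Implicit Types f : 'I_d -> @entry_index n m p.

Definition quotient_chart s f : chart X 'rV[R]_d :=
  Chart [set x : X | gs_domain s (set_val (repr x))]
        (fun x : X => slice_map s f (set_val (repr x))).

Lemma quotient_chart_dom s f (T : NT) :
  chart_dom (quotient_chart s f) (pi T) <-> gs_domain s (set_val T).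
Proof.
rewrite /=; have [U oU ->] := repr_proj T; split; last exact: gs_domain_act.
move=> /(gs_domain_act (U := U^T)); rewrite actM (mulmx1C oU) act1; apply.
by rewrite /orthogonal_mx trmxK (mulmx1C oU).
Qed.

Lemma quotient_chartE s f (T : NT) :
  quotient_chart s f (pi T) = slice_map s f (set_val T).
Proof.
by rewrite /= /slice_map; have [U oU ->] := repr_proj T; rewrite normal_form_act.
Qed.

Lemma normal_form_N s (T : NT) : gs_domain s (set_val T) ->
  exists2 T' : NT, set_val T' = normal_form s (set_val T) & pi T' = pi T.
Proof.
move=> sT; have oQ := orthogonal_gram_schmidt sT.
have [T' T'E] := N_lift (act_N n0 oQ (set_valN T)).
by exists T' => //; apply/esym/N_projP; exists (gram_schmidt s (set_val T).1.1 (set_val T).1.2 n).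
Qed.

(** The inverse of a chart is the projection restricted to the slice; the
neighbourhood conditions thus become conditions on [assemble f y]. *)
Lemma quotient_chart_image s f (O : set X) : admissible s -> framing s f ->
  O `<=` chart_dom (quotient_chart s f) ->
  quotient_chart s f @` O = slice_coords s f `&`
    (assemble f @^-1` (set_val @` (pi @^-1` O))).
Proof.
move=> adm fr Os; apply/seteqP; split=> [_ [x Ox <-]|y [ys [T OT Ty]]].
  have sx := Os _ Ox; split; first exact: slice_map_coords.
  have [T' T'E T'x] := normal_form_N sx.
  exists T'; first by rewrite /= T'x N_proj_repr.
  by rewrite /= assemble_slice_map.
exists (pi T) => //; rewrite quotient_chartE Ty.
exact: slice_map_assemble.
Qed.

Lemma quotient_chart_is_chart s f : admissible s -> framing s f ->
  is_chart (quotient_chart s f).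
Proof.
move=> adm fr; split.
- rewrite open_quotientE.
  have -> : pi @^-1` chart_dom (quotient_chart s f) = set_val @^-1` gs_domain s.
    by apply/seteqP; split=> T;
      [exact: (quotient_chart_dom s f T).1|exact: (quotient_chart_dom s f T).2].
  apply: open_comp; last exact: gs_domain_open.
  by move=> T _; exact: set_val_continuous.
- move=> x y /set_mem sx /set_mem sy /= exy.
  have nfE : normal_form s (set_val (repr x)) = normal_form s (set_val (repr y)).
    by rewrite -(assemble_slice_map fr sx) -(assemble_slice_map fr sy) exy.
  have [T TE Tx] := normal_form_N sx; have [T' T'E Ty] := normal_form_N sy.
  rewrite -(N_proj_repr x) -(N_proj_repr y) -Tx -Ty; congr (pi _).
  by apply: val_inj; exact: etrans TE (etrans nfE (esym T'E)).
- move=> x sx W nW.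
  have [G [oO Ox OW]] : exists O, [/\ open O, O (quotient_chart s f x) & O `<=` W].
    by move: nW; rewrite nbhsE => [[G [? ?] ?]]; exists G.
  have oD : open (gs_domain s `&` slice_map s f @^-1` G).
    rewrite openE => T [sT OT]; apply: filterI.
      exact: (open_nbhs_nbhs (conj (@gs_domain_open R n m p s) sT)).
    have c : slice_map s f @ T --> slice_map s f T := slice_map_Ck s f 0%N T sT.
    by apply: c; exact: (open_nbhs_nbhs (conj oO OT)).
  have : open (chart_dom (quotient_chart s f) `&` quotient_chart s f @^-1` G).
    rewrite open_quotientE.
    have -> : pi @^-1` (chart_dom (quotient_chart s f) `&` quotient_chart s f @^-1` G) =
        set_val @^-1` (gs_domain s `&` slice_map s f @^-1` G).
      have GE T : G (quotient_chart s f (pi T)) = G (slice_map s f (set_val T)).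
        by rewrite quotient_chartE.
      apply/seteqP; split=> T [sT GT]; split.
      - exact: (quotient_chart_dom s f T).1 sT.
      - by move: GT; rewrite [X in X -> _]GE.
      - exact: (quotient_chart_dom s f T).2 sT.
      - by move: GT; rewrite [X in _ -> X]GE.
    by apply: open_comp => // T _; exact: set_val_continuous.
  move=> oP; apply: filterS (open_nbhs_nbhs (conj oP (conj sx Ox))) => y [_].
  exact: OW.
- move=> O oO Os; rewrite quotient_chart_image //; apply: openI.
    exact: slice_coords_open.
  apply: open_comp => [y _|]; first exact: assemble_continuous.
  exact: set_val_open.
Qed.

(** The change of charts is the slice map of [t] on the slice of [s]: both charts
take the same value on a triple and on its normal form. *)
Lemma quotient_transition s f t g : admissible s -> framing s f ->
  admissible t -> framing t g ->
  smooth_coord (quotient_chart s f) (quotient_chart t g) id.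
Proof.
move=> adms frs admt frt D x0 _.
have [oDs injs _ openS] := quotient_chart_is_chart adms frs.
have [oDt _ _ _] := quotient_chart_is_chart admt frt.
have oD : open (quotient_chart s f @` D) by apply: openS => [|x []//]; exact: openI.
split=> // k.
have Dt : quotient_chart s f @` D `<=` assemble f @^-1` gs_domain t.
  move=> _ [x [sx tx] <-]; rewrite /= assemble_slice_map //.
  by apply: gs_domain_act => //; exact: orthogonal_gram_schmidt.
apply: (Ck_ext oD (f := slice_map t g \o assemble f)).
  move=> _ [x [sx tx] <-]; rewrite coord_mapE //.
  rewrite /= assemble_slice_map // /slice_map normal_form_act //.
  exact: orthogonal_gram_schmidt.
apply: (Ck_subset Dt); apply: Ck_comp_linear; first exact: assemble_continuous.
  exact: gs_domain_open.
exact: slice_map_Ck.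
Qed.

Local Notation incl := (Chart setT (set_val : NT -> V)).

Lemma incl_inj : {in chart_dom incl &, injective incl}.
Proof. by move=> T T' _ _; exact: val_inj. Qed.

Lemma proj_coordE s f (T0 : NT) (T : V) : N R n m p T ->
  coord_map T0 incl (quotient_chart s f) pi T = slice_map s f T.
Proof.
by move=> /N_lift[T' <-]; rewrite (coord_mapE _ _ _ incl_inj) // quotient_chartE.
Qed.

Lemma proj_smooth_coord s f : admissible s -> framing s f ->
  smooth_coord incl (quotient_chart s f) pi.
Proof.
move=> adm fr D T0 _.
have DE : incl @` D = N R n m p `&` gs_domain s.
  apply/seteqP; split=> [_ [T [_ sT] <-]|T [/N_lift[T' <-] sT]].
    by split; [exact: (set_valN T)|exact: (quotient_chart_dom s f T).1 sT].
  by exists T' => //; split=> //; exact: (quotient_chart_dom s f T').2 sT.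
have oD : open (incl @` D) by rewrite DE; apply: openI; [exact: N_open|exact: gs_domain_open].
split=> // k; apply: (Ck_ext oD (f := slice_map s f)).
  by rewrite DE => T [NTT _]; rewrite proj_coordE.
by apply: Ck_subset (slice_map_Ck s f k) => T; rewrite DE => -[].
Qed.

(** With Q the rotation that brings T to its normal form, y |-> Q^T o (slice point y)
is a linear section of the projection in coordinates, and it passes through T; so
the differential at T has a right inverse. *)
Lemma proj_diff_surjective s f (T : NT) : admissible s -> framing s f ->
  gs_domain s (set_val T) -> forall w : 'rV[R]_d, exists v : V,
    'd (coord_map T incl (quotient_chart s f) pi) (incl T) v = w.
Proof.
move=> adm fr sT w.
pose Q := gram_schmidt s (set_val T).1.1 (set_val T).1.2 n.
have oQ : orthogonal_mx Q by exact: orthogonal_gram_schmidt.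
have oQt : orthogonal_mx Q^T by rewrite /orthogonal_mx trmxK; exact: mulmx1C.
pose secL : {linear 'rV[R]_d -> V} := (act Q^T \o assemble f)%FUN.
have csec : continuous secL.
  move=> y; apply: continuous_comp; first exact: assemble_continuous.
  exact: act_continuous.
pose y0 := slice_map s f (set_val T).
have secy0 : secL y0 = set_val T.
  rewrite /= assemble_slice_map // /normal_form actM -/Q.
  by rewrite (mulmx1C oQ) act1.
have oN := N_open n0 (R := R) (m := m) (p := p).
pose F := coord_map T incl (quotient_chart s f) pi.
have [dF _] : Ck 1 (N R n m p `&` gs_domain s) F.
  have oW : open (N R n m p `&` gs_domain s) by apply: openI => //; exact: gs_domain_open.
  apply: (Ck_ext oW (f := slice_map s f)).
  - by move=> T' [NT' _]; rewrite /F proj_coordE.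
  - by apply: Ck_subset (slice_map_Ck s f 1) => T' [].
have dFT : differentiable F (secL y0).
  by rewrite secy0; apply: dF; split=> //; exact: set_valN.
have idE : \forall y \near y0, y = (F \o secL) y.
  have nS : \forall y \near y0, slice_coords s f y.
    have ys := slice_map_coords fr sT.
    exact: (open_nbhs_nbhs (conj (@slice_coords_open R n m p d s f) ys)).
  have nN : \forall y \near y0, N R n m p (secL y).
    by apply: csec; rewrite secy0; exact: (open_nbhs_nbhs (conj oN (set_valN T))).
  apply: filterS2 nS nN => y ys yN; rewrite /= /F proj_coordE //.
  by rewrite /slice_map normal_form_act // -/(slice_map s f _) slice_map_assemble.
have did : differentiable (id : 'rV[R]_d -> 'rV[R]_d) y0 by apply: ex_diff.
have [_ dE] := near_eq_diff idE did.
exists (secL w); suff: 'd F (secL y0) (secL w) = w by rewrite secy0.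
have dsec : differentiable secL y0 by exact: linear_differentiable.
have compE := congr1 (fun h => h w) (diff_comp dsec dFT).
have secE := congr1 (fun h => h w) (diff_lin y0 csec).
have idwE : 'd (id : 'rV[R]_d -> 'rV[R]_d) y0 w = w by rewrite diff_val.
by rewrite -[RHS]idwE -dE compE /= secE.
Qed.

End QuotientManifold.

Theorem mainTheorem1 (R : realType) (n m p : nat)
    (hn : (1 <= n)%N) (hm : (1 <= m)%N) (hp : (1 <= p)%N) :
  exists (d : nat) (A : set (chart (N_mod_O R n m p) 'rV[R]_d)),
    smooth_manifold A /\
    smooth_submersion (N_atlas R n m p) A (N_proj R n m p).
Proof.
pose d := @quotient_dim n m p.
pose A : set (chart (N_mod_O R n m p) 'rV[R]_d) :=
  [set phi | exists s f, [/\ admissible s, @framing n m p d s f & phi = quotient_chart s f]].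
exists d, A; split; first split.
- exact: quotient_hausdorff.
- exact: quotient_second_countable.
- by move=> _ [s [f [adm fr ->]]]; exact: quotient_chart_is_chart.
- move=> x; have [_ cT _] := set_valN (repr x).
  have [s sT] := controllable_nondegenerate hn cT.
  have [adm _] := gram_schmidt_in_slice sT.
  have [f fr] := @exists_framing n m p s adm.
  by exists (quotient_chart s f) => //; exists s, f.
- move=> _ _ [s [f [adms frs ->]]] [t [g [admt frt ->]]].
  exact: quotient_transition.
split.
  split; first exact: N_proj_continuous.
  move=> _ _ -> [s [f [adm fr ->]]]; exact: proj_smooth_coord.
move=> _ _ T -> [s [f [adm fr ->]]] _ sT.
exact: proj_diff_surjective adm fr ((quotient_chart_dom s f T).1 sT).
Qed.
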